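(* Let $n\geq1$ and $r\geq2$ be integers, let $p_1,\ldots,p_r$ be real numbers with $0\leq p_i\leq(r-1)/r$ for every $i\in[r]$, and let $\mathcal A_1,\ldots,\mathcal A_r\subseteq2^{[n]}$ be $r$-cross-intersecting. Then $$\prod_{i=1}^r\mu_{p_i}(\mathcal A_i)\leq\prod_{i=1}^rp_i.$$ The equality cases are as follows. (a) If some $p_i=0$, both sides are zero for all such families. (b) Suppose that $p_i>0$ for every $i$. If $r\geq3$, or if $r=2$ and $(p_1,p_2)\neq(1/2,1/2)$, then equality holds if and only if the families are full $1$-stars with a common center, i.e. there is $x\in[n]$ with $\mathcal A_i=\{A\subseteq[n]:x\in A\}$ for every $i\in[r]$. (c) If $r=2$ and $p_1=p_2=1/2$, equality holds if and only if there is an increasing family $\mathcal A\subseteq2^{[n]}$ with $\mu_{1/2}(\mathcal A)=1/2$ such that $$\mathcal A_1=\mathcal A\quad\text{and}\quad\mathcal A_2=\{B\subseteq[n]:[n]\setminus B\notin\mathcal A\}.$$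
   Context: $[n]=\{1,\ldots,n\}$ and $2^{[n]}$ is its power set. For $0\le p\le 1$ and $\mathcal A\subseteq2^{[n]}$, $\mu_p(\mathcal A)=\sum_{A\in\mathcal A}p^{|A|}(1-p)^{n-|A|}$ (with $0^0=1$). Families $\mathcal A_1,\ldots,\mathcal A_r\subseteq 2^{[n]}$ are $r$-cross-intersecting if $A_1\cap\cdots\cap A_r\neq\varnothing$ whenever $A_i\in\mathcal A_i$ for every $i\in[r]$. A family $\mathcal A\subseteq2^{[n]}$ is increasing if $A\in\mathcal A$ and $A\subseteq B\subseteq[n]$ imply $B\in\mathcal A$. *)

(* Defs.v *)
From mathcomp Require Import all_boot all_order all_algebra.
From mathcomp Require Import reals.

Set Implicit Arguments.
Unset Strict Implicit.
Unset Printing Implicit Defensive.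

Import Order.TTheory GRing.Theory Num.Theory.

Local Open Scope ring_scope.

(* [n] = {1, ..., n} is represented by 'I_n and [r] by 'I_r, so indices are
   shifted by one. *)

(* The convention 0^0 = 1 holds definitionally for _ ^+ _. *)
Definition mu (R : realType) (n : nat) (p : R) (F : {set {set 'I_n}}) : R :=
  \sum_(A in F) p ^+ #|A| * (1 - p) ^+ (n - #|A|).

Definition cross_intersecting (n r : nat) (F : 'I_r -> {set {set 'I_n}}) : Prop :=
  forall A : 'I_r -> {set 'I_n},
    (forall i, A i \in F i) -> \bigcap_(i < r) A i != set0.

Definition increasing_family (n : nat) (F : {set {set 'I_n}}) : Prop :=
  forall A B : {set 'I_n}, A \in F -> A \subset B -> B \in F.

Definition full_star (n : nat) (x : 'I_n) : {set {set 'I_n}} :=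
  [set A : {set 'I_n} | x \in A].

Definition dual_family (n : nat) (F : {set {set 'I_n}}) : {set {set 'I_n}} :=
  [set B : {set 'I_n} | ~: B \notin F].

(* The indices written 1 and 2 in [r], available since r >= 2. *)
Definition idx1 (r : nat) (hr : (2 <= r)%N) : 'I_r := Ordinal (ltnW hr).
Definition idx2 (r : nat) (hr : (2 <= r)%N) : 'I_r := Ordinal hr.

(* Main.v *)
(** Passing to up-closures, assume the families increasing.  Let
    o_i = p_i / (1 - p_i); as the sum of 1 / (1 + o_i) = 1 - p_i is at least 1,
    there is c >= 0 for which a_i = 1 / (1 + (1 + c) o_i) sum to 1.  The
    involution k(s) = (1 - s) / (1 + c s) exchanges p_i and a_i, and for every
    partial assignment of the coordinates with empty intersection the
    conditional measures m_i satisfy both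
      prod m_i <= prod p_i   and   sum k(m_i) >= 1.
    Both are proved together by induction on the number of free coordinates.
    Revealing one coordinate turns m_i into p_i x_i + (1 - p_i) y_i with
    y_i <= x_i, the induction hypothesis being used for the tuples in which a
    single x_i is replaced by y_i.  The second bound is then a convexity
    inequality; in the first, the product is log-convex in (a_i), so that only
    the vertices of the simplex matter, where it becomes a polynomial
    inequality.

    If c > 0, equality in one step forces x_i = y_i for all i, or x_i = 1 and
    y_i = 0 for all i.  Any coordinate may be revealed first, so either some
    coordinate is the centre of a star or no family depends on any coordinate.
    If c = 0, all p_i equal (r - 1) / r, and the arithmetic-geometric mean
    inequality makes the sum of the 1 - mu(A_i) equal to 1.  Hence for every
    ordered partition of [n] into r parts exactly one complement of a part is
    missing from its family, which for r >= 3 forces stars.  For r = 2 and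
    p = 1/2, complementation gives A_2 inside the dual of A_1. *)

Require Import Defs.
From mathcomp Require Import all_boot all_order all_algebra.
From mathcomp Require Import reals ring lra.

Set Implicit Arguments.
Unset Strict Implicit.
Unset Printing Implicit Defensive.

Import Order.TTheory GRing.Theory Num.Theory.

Local Open Scope ring_scope.

Ltac nonneg_sum := repeat first [assumption | apply: ler0n | apply: addr_ge0
  | apply: mulr_ge0 | apply: exprn_ge0].

(* In the four lemmas below the sign of [K] says which of the two upper bounds
   on [W] in [vertex_bound] is the smaller one.  In terms of [g = 1 - u - E]
   the difference of the two sides is [M * K + Q], up to the displayed slack,
   where [M] and [Q] have nonnegative coefficients; the suffix is the value
   of [nu]. *)
Lemma small_slack_0 (R : realFieldType) (c u E : R) :
  0 <= c -> 0 <= u -> 0 <= E -> u + E <= 1 ->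
  (1 + c) ^+ 2 * E * (1 + c * u) <= (1 - u) * (1 + c - c * E) ->
  c * ((u + E) * (1 - u - E) ^+ 4) <=
  2 * ((1 + c * u) * (1 + c * E) *
    ((1 + c) * (1 + E) - (u + E) * (1 + c * (u + E))) * (1 + c - c * E) -
    (1 + c) * ((1 - u) * (1 + c - c * E) + c * ((1 + c) * E * (1 + c * u)))).
Proof.
move=> c0 u0 E0 uE; rewrite -subr_ge0.
pose K := (1 - u) * (1 + c - c * E) - (1 + c) ^+ 2 * E * (1 + c * u).
rewrite -/K => K0; pose g := 1 - u - E; have g0 : 0 <= g by rewrite /g; lra.
pose M :=
  4 * E ^+ 2 * g + 2 * E ^+ 3 + 4 * u * E ^+ 2 + 3 * u ^+ 3 + 4 * c * u ^+ 2 *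
  E + 2 * c * u ^+ 3.
pose Q :=
  E * g ^+ 4 + 2 * E ^+ 2 * g ^+ 3 + 3 * u * g ^+ 4 + 18 * u * E * g ^+ 3 + 16
  * u * E ^+ 2 * g ^+ 2 + 4 * u * E ^+ 3 * g + 12 * u ^+ 2 * g ^+ 3 + 30 * u
  ^+ 2 * E * g ^+ 2 + 14 * u ^+ 2 * E ^+ 2 * g + 9 * u ^+ 3 * g ^+ 2 + 11 * u
  ^+ 3 * E * g + u ^+ 4 * g + 2 * c * E * g ^+ 4 + 2 * c * E ^+ 3 * g ^+ 2 + 6
  * c * E ^+ 4 * g + 2 * c * E ^+ 5 + 6 * c * u * g ^+ 4 + 24 * c * u * E * g
  ^+ 3 + 16 * c * u * E ^+ 2 * g ^+ 2 + 10 * c * u * E ^+ 3 * g + 6 * c * u *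
  E ^+ 4 + 20 * c * u ^+ 2 * g ^+ 3 + 40 * c * u ^+ 2 * E * g ^+ 2 + 8 * c * u
  ^+ 2 * E ^+ 2 * g + 17 * c * u ^+ 3 * g ^+ 2 + 17 * c * u ^+ 3 * E * g + 3 *
  c * u ^+ 4 * g + 4 * c * u ^+ 4 * E + 2 * c ^+ 2 * u * g ^+ 4 + 8 * c ^+ 2 *
  u * E * g ^+ 3 + 4 * c ^+ 2 * u * E ^+ 2 * g ^+ 2 + 4 * c ^+ 2 * u * E ^+ 3
  * g + 2 * c ^+ 2 * u * E ^+ 4 + 8 * c ^+ 2 * u ^+ 2 * g ^+ 3 + 12 * c ^+ 2 *
  u ^+ 2 * E * g ^+ 2 + 8 * c ^+ 2 * u ^+ 2 * E ^+ 3 + 8 * c ^+ 2 * u ^+ 3 * g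
  ^+ 2 + 5 * c ^+ 2 * u ^+ 3 * E * g + 5 * c ^+ 2 * u ^+ 3 * E ^+ 2 + 2 * c ^+
  2 * u ^+ 4 * g + 9 * c ^+ 2 * u ^+ 4 * E + 4 * c ^+ 3 * u ^+ 2 * E ^+ 3 + 10
  * c ^+ 3 * u ^+ 3 * E ^+ 2 + 7 * c ^+ 3 * u ^+ 4 * E + 4 * c ^+ 4 * u ^+ 3 *
  E ^+ 2 + 2 * c ^+ 4 * u ^+ 4 * E.
have M0 : 0 <= M by rewrite /M; nonneg_sum.
have Q0 : 0 <= Q by rewrite /Q; nonneg_sum.
have eqn : 2 * ((1 + c * u) * (1 + c * E) *
    ((1 + c) * (1 + E) - (u + E) * (1 + c * (u + E))) * (1 + c - c * E) -
    (1 + c) * ((1 - u) * (1 + c - c * E) + c * ((1 + c) * E * (1 + c * u)))) =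
    c * (M * K + Q + (u + E) * g ^+ 4).
  by rewrite /M /K /Q /g; field.
rewrite eqn -/g; apply: ler_wpM2l => //; rewrite lerDr addr_ge0 ?mulr_ge0 //.
Qed.

Lemma large_slack_0 (R : realFieldType) (c u E : R) :
  0 <= c -> 0 <= u -> 0 <= E -> u + E <= 1 ->
  (1 - u) * (1 + c - c * E) <= (1 + c) ^+ 2 * E * (1 + c * u) ->
  c ^+ 2 * E ^+ 4 <=
  2 * (1 + c) ^+ 2 * ((1 + c * u) * (1 + c * E) *
    ((1 + c) * (1 + E) - (u + E) * (1 + c * (u + E))) -
    (1 - u) * (1 + c + c)).
Proof.
move=> c0 u0 E0 uE; rewrite -subr_ge0.
pose K := (1 + c) ^+ 2 * E * (1 + c * u) - (1 - u) * (1 + c - c * E).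
rewrite -/K => K0; pose g := 1 - u - E; have g0 : 0 <= g by rewrite /g; lra.
pose M :=
  3 * g ^+ 2 + 2 * E * g + 2 * c * g ^+ 2 + 5 * c * E * g.
pose Q :=
  g ^+ 4 + E * g ^+ 3 + u * g ^+ 3 + 2 * u * E * g ^+ 2 + 2 * u * E ^+ 2 * g +
  2 * u ^+ 2 * g ^+ 2 + 4 * u ^+ 2 * E * g + 2 * u ^+ 3 * g + c * g ^+ 4 + c *
  E ^+ 2 * g ^+ 2 + 4 * c * E ^+ 3 * g + c * E ^+ 4 + 3 * c * u * g ^+ 3 + 17
  * c * u * E * g ^+ 2 + 24 * c * u * E ^+ 2 * g + 8 * c * u * E ^+ 3 + 10 * c
  * u ^+ 2 * g ^+ 2 + 26 * c * u ^+ 2 * E * g + 8 * c * u ^+ 2 * E ^+ 2 + 8 *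
  c * u ^+ 3 * g + 2 * c * u ^+ 3 * E + 4 * c ^+ 2 * E ^+ 3 * g + 4 * c ^+ 2 *
  E ^+ 4 + 4 * c ^+ 2 * u * g ^+ 3 + 26 * c ^+ 2 * u * E * g ^+ 2 + 40 * c ^+
  2 * u * E ^+ 2 * g + 18 * c ^+ 2 * u * E ^+ 3 + 14 * c ^+ 2 * u ^+ 2 * g ^+
  2 + 44 * c ^+ 2 * u ^+ 2 * E * g + 18 * c ^+ 2 * u ^+ 2 * E ^+ 2 + 10 * c ^+
  2 * u ^+ 3 * g + 4 * c ^+ 2 * u ^+ 3 * E + c ^+ 3 * E ^+ 2 * g ^+ 2 + 3 * c
  ^+ 3 * E ^+ 3 * g + 2 * c ^+ 3 * E ^+ 4 + 2 * c ^+ 3 * u * g ^+ 3 + 11 * c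
  ^+ 3 * u * E * g ^+ 2 + 19 * c ^+ 3 * u * E ^+ 2 * g + 12 * c ^+ 3 * u * E
  ^+ 3 + 6 * c ^+ 3 * u ^+ 2 * g ^+ 2 + 26 * c ^+ 3 * u ^+ 2 * E * g + 12 * c
  ^+ 3 * u ^+ 2 * E ^+ 2 + 4 * c ^+ 3 * u ^+ 3 * g + 2 * c ^+ 3 * u ^+ 3 * E +
  c ^+ 4 * u * E ^+ 2 * g + 2 * c ^+ 4 * u * E ^+ 3 + 4 * c ^+ 4 * u ^+ 2 * E
  * g + 2 * c ^+ 4 * u ^+ 2 * E ^+ 2.
have M0 : 0 <= M by rewrite /M; nonneg_sum.
have Q0 : 0 <= Q by rewrite /Q; nonneg_sum.
have eqn : 2 * (1 + c) ^+ 2 * ((1 + c * u) * (1 + c * E) *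
    ((1 + c) * (1 + E) - (u + E) * (1 + c * (u + E))) -
    (1 - u) * (1 + c + c)) =
    c * (M * K + Q + c * E ^+ 4).
  by rewrite /M /K /Q /g; field.
rewrite eqn expr2 -mulrA; apply: ler_wpM2l => //; rewrite lerDr addr_ge0 ?mulr_ge0 //.
Qed.

Lemma small_slack_half (R : realFieldType) (c u E : R) :
  0 <= c -> 0 <= u -> 0 <= E -> u + E <= 1 ->
  (1 + c) ^+ 2 * E * (1 + c * u) <= (1 - u) * (1 + c - c * E) ->
  c * ((u + E) * (1 - u - E) ^+ 4) <=
  16 * ((1 + c * u) * (1 + c * E) *
    ((1 + c) * (1 + E) - (u + E - E / 2%:R) * (1 + c * (u + E))) * (1 + c - c * E) -
    (1 + c) * ((1 - u) * (1 + c - c * E) + (c + 2%:R^-1) * ((1 + c) * E * (1 + c * u)))).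
Proof.
move=> c0 u0 E0 uE; rewrite -subr_ge0.
pose K := (1 - u) * (1 + c - c * E) - (1 + c) ^+ 2 * E * (1 + c * u).
rewrite -/K => K0; pose g := 1 - u - E; have g0 : 0 <= g by rewrite /g; lra.
pose M :=
  7 * E * g ^+ 2 + 14 * E ^+ 2 * g + 8 * E ^+ 3 + 24 * u * E ^+ 2 + 20 * u ^+
  3 + 7 * c * E ^+ 2 * g + 4 * c * E ^+ 3 + 24 * c * u ^+ 2 * E + 16 * c * u
  ^+ 3.
pose Q :=
  3 * E ^+ 2 * g ^+ 3 + 2 * E ^+ 3 * g ^+ 2 + 31 * u * g ^+ 4 + 113 * u * E *
  g ^+ 3 + 106 * u * E ^+ 2 * g ^+ 2 + 24 * u * E ^+ 3 * g + 96 * u ^+ 2 * g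
  ^+ 3 + 216 * u ^+ 2 * E * g ^+ 2 + 96 * u ^+ 2 * E ^+ 2 * g + 76 * u ^+ 3 *
  g ^+ 2 + 84 * u ^+ 3 * E * g + 12 * u ^+ 4 * g + c * E * g ^+ 4 + 2 * c * E
  ^+ 2 * g ^+ 3 + c * E ^+ 3 * g ^+ 2 + 48 * c * u * g ^+ 4 + 153 * c * u * E
  * g ^+ 3 + 121 * c * u * E ^+ 2 * g ^+ 2 + 40 * c * u * E ^+ 3 * g + 24 * c
  * u * E ^+ 4 + 160 * c * u ^+ 2 * g ^+ 3 + 288 * c * u ^+ 2 * E * g ^+ 2 +
  64 * c * u ^+ 2 * E ^+ 2 * g + 140 * c * u ^+ 3 * g ^+ 2 + 124 * c * u ^+ 3
  * E * g + 28 * c * u ^+ 4 * g + 24 * c * u ^+ 4 * E + 16 * c ^+ 2 * u * g ^+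
  4 + 56 * c ^+ 2 * u * E * g ^+ 3 + 46 * c ^+ 2 * u * E ^+ 2 * g ^+ 2 + 4 * c
  ^+ 2 * u * E ^+ 3 * g + 64 * c ^+ 2 * u ^+ 2 * g ^+ 3 + 88 * c ^+ 2 * u ^+ 2
  * E * g ^+ 2 + 8 * c ^+ 2 * u ^+ 2 * E ^+ 2 * g + 48 * c ^+ 2 * u ^+ 2 * E
  ^+ 3 + 64 * c ^+ 2 * u ^+ 3 * g ^+ 2 + 36 * c ^+ 2 * u ^+ 3 * E * g + 36 * c
  ^+ 2 * u ^+ 3 * E ^+ 2 + 16 * c ^+ 2 * u ^+ 4 * g + 60 * c ^+ 2 * u ^+ 4 * E
  + 7 * c ^+ 3 * E ^+ 3 * g ^+ 2 + 11 * c ^+ 3 * E ^+ 4 * g + 4 * c ^+ 3 * E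
  ^+ 5 + 7 * c ^+ 3 * u * E ^+ 2 * g ^+ 2 + 11 * c ^+ 3 * u * E ^+ 3 * g + 4 *
  c ^+ 3 * u * E ^+ 4 + 24 * c ^+ 3 * u ^+ 2 * E ^+ 3 + 64 * c ^+ 3 * u ^+ 3 *
  E ^+ 2 + 52 * c ^+ 3 * u ^+ 4 * E + 7 * c ^+ 4 * u * E ^+ 3 * g + 4 * c ^+ 4
  * u * E ^+ 4 + 24 * c ^+ 4 * u ^+ 3 * E ^+ 2 + 16 * c ^+ 4 * u ^+ 4 * E.
have M0 : 0 <= M by rewrite /M; nonneg_sum.
have Q0 : 0 <= Q by rewrite /Q; nonneg_sum.
have eqn : 16 * ((1 + c * u) * (1 + c * E) *
    ((1 + c) * (1 + E) - (u + E - E / 2%:R) * (1 + c * (u + E))) * (1 + c - c * E) -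
    (1 + c) * ((1 - u) * (1 + c - c * E) + (c + 2%:R^-1) * ((1 + c) * E * (1 + c * u)))) =
    c * (M * K + Q + (u + E) * g ^+ 4).
  by rewrite /M /K /Q /g; field.
rewrite eqn -/g; apply: ler_wpM2l => //; rewrite lerDr addr_ge0 ?mulr_ge0 //.
Qed.

Lemma large_slack_half (R : realFieldType) (c u E : R) :
  0 <= c -> 0 <= u -> 0 <= E -> u + E <= 1 ->
  (1 - u) * (1 + c - c * E) <= (1 + c) ^+ 2 * E * (1 + c * u) ->
  c ^+ 3 * E ^+ 4 <=
  2 * (1 + c) ^+ 2 * ((1 + c * u) * (1 + c * E) *
    ((1 + c) * (1 + E) - (u + E - E / 2%:R) * (1 + c * (u + E))) -
    (1 - u) * (1 + c + (c + 2%:R^-1))).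
Proof.
move=> c0 u0 E0 uE; rewrite -subr_ge0.
pose K := (1 + c) ^+ 2 * E * (1 + c * u) - (1 - u) * (1 + c - c * E).
rewrite -/K => K0; pose g := 1 - u - E; have g0 : 0 <= g by rewrite /g; lra.
pose M :=
  g ^+ 2 + 2 * E * g + E ^+ 2 + 4 * u * g + 2 * u * E + u ^+ 2 + 3 * c * g ^+
  2 + 6 * c * E * g + 3 * c * E ^+ 2 + 6 * c * u * E + 2 * c ^+ 2 * g ^+ 2 + 5
  * c ^+ 2 * E * g + 2 * c ^+ 2 * E ^+ 2.
pose Q :=
  2 * u * g ^+ 3 + 2 * u * E * g ^+ 2 + 2 * u ^+ 2 * g ^+ 2 + c * u ^+ 2 * g
  ^+ 2 + c * u ^+ 2 * E * g + c * u ^+ 3 * g + 18 * c ^+ 2 * u * E * g ^+ 2 +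
  19 * c ^+ 2 * u * E ^+ 2 * g + c ^+ 2 * u * E ^+ 3 + 7 * c ^+ 2 * u ^+ 2 * g
  ^+ 2 + 25 * c ^+ 2 * u ^+ 2 * E * g + 5 * c ^+ 2 * u ^+ 2 * E ^+ 2 + 7 * c
  ^+ 2 * u ^+ 3 * g + 4 * c ^+ 2 * u ^+ 3 * E + c ^+ 3 * E ^+ 3 * g + 4 * c ^+
  3 * u * g ^+ 3 + 27 * c ^+ 3 * u * E * g ^+ 2 + 36 * c ^+ 3 * u * E ^+ 2 * g
  + 13 * c ^+ 3 * u * E ^+ 3 + 14 * c ^+ 3 * u ^+ 2 * g ^+ 2 + 46 * c ^+ 3 * u
  ^+ 2 * E * g + 13 * c ^+ 3 * u ^+ 2 * E ^+ 2 + 10 * c ^+ 3 * u ^+ 3 * g + 7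
  * c ^+ 3 * u ^+ 3 * E + c ^+ 4 * E ^+ 2 * g ^+ 2 + 2 * c ^+ 4 * E ^+ 3 * g +
  c ^+ 4 * E ^+ 4 + 2 * c ^+ 4 * u * g ^+ 3 + 11 * c ^+ 4 * u * E * g ^+ 2 +
  18 * c ^+ 4 * u * E ^+ 2 * g + 9 * c ^+ 4 * u * E ^+ 3 + 6 * c ^+ 4 * u ^+ 2
  * g ^+ 2 + 27 * c ^+ 4 * u ^+ 2 * E * g + 12 * c ^+ 4 * u ^+ 2 * E ^+ 2 + 4
  * c ^+ 4 * u ^+ 3 * g + 3 * c ^+ 4 * u ^+ 3 * E + c ^+ 5 * u * E ^+ 2 * g +
  c ^+ 5 * u * E ^+ 3 + 4 * c ^+ 5 * u ^+ 2 * E * g + 3 * c ^+ 5 * u ^+ 2 * E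
  ^+ 2.
have M0 : 0 <= M by rewrite /M; nonneg_sum.
have Q0 : 0 <= Q by rewrite /Q; nonneg_sum.
have eqn : 2 * (1 + c) ^+ 2 * ((1 + c * u) * (1 + c * E) *
    ((1 + c) * (1 + E) - (u + E - E / 2%:R) * (1 + c * (u + E))) -
    (1 - u) * (1 + c + (c + 2%:R^-1))) =
    (M * K + Q + c ^+ 3 * E ^+ 4).
  by rewrite /M /K /Q /g; field.
rewrite eqn lerDr addr_ge0 ?mulr_ge0 //.
Qed.

Lemma pair_small_slack (R : realFieldType) (c u v : R) :
  0 <= c -> 0 <= u -> 0 <= v -> u + v <= 1 ->
  (1 + c) ^+ 2 * v * (1 + c * u) <= (1 - u) * (1 + c - c * v) ->
  c ^+ 2 * (v ^+ 4 + u ^+ 4) <=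
  3 * ((1 + c * u) * (1 + c * v) * (1 + c - c * u) * (1 + c - c * v) -
    ((1 - u) * (1 + c - c * v) + (1 + c) ^+ 2 * v * (1 + c * u)) *
    ((1 - v) * (1 + c - c * u) + u * (1 + c * v))).
Proof.
move=> c0 u0 v0 uv; rewrite -subr_ge0.
pose K := (1 - u) * (1 + c - c * v) - (1 + c) ^+ 2 * v * (1 + c * u).
rewrite -/K => K0; pose g := 1 - u - v; have g0 : 0 <= g by rewrite /g; lra.
pose M := 6 * c * u * v + 3 * c * u ^+ 2.
pose N :=
  3 * g ^+ 2 + 6 * v * g + 3 * v ^+ 2 + 6 * u * g + 6 * u * v + 3 * u ^+ 2 + 3
  * c * g ^+ 2 + 11 * c * v * g + 6 * c * v ^+ 2 + 10 * c * u * g + 12 * c * u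
  * v + 6 * c * u ^+ 2.
pose Q :=
  3 * c * v ^+ 2 * g ^+ 2 + c * v ^+ 3 * g + 6 * c * u * g ^+ 3 + 12 * c * u
  ^+ 2 * g ^+ 2 + 5 * c * u ^+ 3 * g + 3 * c ^+ 2 * v ^+ 2 * g ^+ 2 + 6 * c ^+
  2 * v ^+ 3 * g + 2 * c ^+ 2 * v ^+ 4 + 9 * c ^+ 2 * u * g ^+ 3 + 3 * c ^+ 2
  * u * v ^+ 2 * g + 12 * c ^+ 2 * u * v ^+ 3 + 18 * c ^+ 2 * u ^+ 2 * g ^+ 2
  + 3 * c ^+ 2 * u ^+ 2 * v * g + 12 * c ^+ 2 * u ^+ 3 * g + 6 * c ^+ 2 * u ^+
  3 * v + 2 * c ^+ 2 * u ^+ 4 + 3 * c ^+ 3 * u * g ^+ 3 + 3 * c ^+ 3 * u * v *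
  g ^+ 2 + 6 * c ^+ 3 * u * v ^+ 2 * g + 6 * c ^+ 3 * u * v ^+ 3 + 6 * c ^+ 3
  * u ^+ 2 * g ^+ 2 + 6 * c ^+ 3 * u ^+ 2 * v * g + 9 * c ^+ 3 * u ^+ 2 * v ^+
  2 + 3 * c ^+ 3 * u ^+ 3 * g + 9 * c ^+ 3 * u ^+ 3 * v + 3 * c ^+ 4 * u ^+ 2
  * v ^+ 2 + 3 * c ^+ 4 * u ^+ 3 * v.
have M0 : 0 <= M by rewrite /M; nonneg_sum.
have N0 : 0 <= N by rewrite /N; nonneg_sum.
have Q0 : 0 <= Q by rewrite /Q; nonneg_sum.
have -> : 3 * ((1 + c * u) * (1 + c * v) * (1 + c - c * u) * (1 + c - c * v) -
    ((1 - u) * (1 + c - c * v) + (1 + c) ^+ 2 * v * (1 + c * u)) *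
    ((1 - v) * (1 + c - c * u) + u * (1 + c * v))) =
    M * K + N * (v - u) ^+ 2 + Q + c ^+ 2 * (v ^+ 4 + u ^+ 4).
  by rewrite /M /N /K /Q /g; ring.
rewrite lerDr addr_ge0 // addr_ge0 //; first exact: mulr_ge0.
by apply: mulr_ge0; rewrite ?sqr_ge0.
Qed.

Lemma pair_large_slack (R : realFieldType) (c u v : R) :
  0 <= c -> 0 <= u -> 0 <= v -> u + v <= 1 ->
  (1 - u) * (1 + c - c * v) <= (1 + c) ^+ 2 * v * (1 + c * u) ->
  c ^+ 2 * (v ^+ 3 + u ^+ 3) <=
  2 * (1 + c) * ((1 + c * u) * (1 + c * v) * (1 + c - c * u) -
    2 * (1 - u) * ((1 - v) * (1 + c - c * u) + u * (1 + c * v))).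
Proof.
move=> c0 u0 v0 uv; rewrite -subr_ge0.
pose K := (1 + c) ^+ 2 * v * (1 + c * u) - (1 - u) * (1 + c - c * v).
rewrite -/K => K0; pose g := 1 - u - v; have g0 : 0 <= g by rewrite /g; lra.
pose M := 2 * g + 4 * u + 2 * c * g + 2 * c * v.
pose N :=
  2 * g + 2 * v + 2 * u + 5 * c * g + 6 * c * v + 4 * c * u.
pose Q :=
  c * v ^+ 2 * g + 4 * c * u * g ^+ 2 + 3 * c * u ^+ 2 * g + 2 * c ^+ 2 * v ^+
  2 * g + c ^+ 2 * v ^+ 3 + 6 * c ^+ 2 * u * g ^+ 2 + 8 * c ^+ 2 * u ^+ 2 * g
  + c ^+ 2 * u ^+ 3 + 2 * c ^+ 3 * u * g ^+ 2 + 2 * c ^+ 3 * u * v * g + 2 * c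
  ^+ 3 * u * v ^+ 2 + 2 * c ^+ 3 * u ^+ 2 * g.
have M0 : 0 <= M by rewrite /M; nonneg_sum.
have N0 : 0 <= N by rewrite /N; nonneg_sum.
have Q0 : 0 <= Q by rewrite /Q; nonneg_sum.
have -> : 2 * (1 + c) * ((1 + c * u) * (1 + c * v) * (1 + c - c * u) -
    2 * (1 - u) * ((1 - v) * (1 + c - c * u) + u * (1 + c * v))) =
    M * K + N * (v - u) ^+ 2 + Q + c ^+ 2 * (v ^+ 3 + u ^+ 3).
  by rewrite /M /N /K /Q /g; ring.
rewrite lerDr addr_ge0 // addr_ge0 //; first exact: mulr_ge0.
by apply: mulr_ge0; rewrite ?sqr_ge0.
Qed.

Lemma ler_by_slack (R : realFieldType) (k d x y : R) :
  0 < k -> 0 <= d -> d <= k * (y - x) -> x <= y.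
Proof. by move=> k0 d0 h; rewrite -subr_ge0 -(pmulr_rge0 _ k0) (le_trans d0). Qed.

Lemma ltr_by_slack (R : realFieldType) (k d x y : R) :
  0 < k -> 0 < d -> d <= k * (y - x) -> x < y.
Proof. by move=> k0 d0 h; rewrite -subr_gt0 -(pmulr_rgt0 _ k0) (lt_le_trans d0). Qed.

(* Affine in [nu], hence a convex combination of the cases 0 and 1/2. *)
Lemma vertex_bound (R : realFieldType) (c nu u E W : R) :
  0 <= c -> 0 <= nu -> nu <= 2^-1 -> 0 <= u -> 0 <= E -> u + E < 1 ->
  W * (1 + c - c * E) <= (1 + c) * E * (1 + c * u) -> (1 + c) * W <= 1 - u ->
  let t := (1 + c * u) * (1 + c * E) *
    ((1 + c) * (1 + E) - (u + E - nu * E) * (1 + c * (u + E))) in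
  let l := (1 + c) * (1 - u + (c + nu) * W) in
  l <= t /\ (0 < c -> 0 < u + E -> l < t).
Proof.
move=> c0 nu0 nu2 u0 E0 uE hW1 hW2 t l.
have rE : 0 < 1 + c - c * E by nra.
have c1 : 0 < 1 + c by lra.
have uE' : u + E <= 1 by lra.
have g0 : 0 < 1 - u - E by lra.
have [K|K] := leP ((1 + c) ^+ 2 * E * (1 + c * u)) ((1 - u) * (1 + c - c * E)).
  have h0 := small_slack_0 c0 u0 E0 uE' K.
  have h1 := small_slack_half c0 u0 E0 uE' K.
  pose d := c * ((u + E) * (1 - u - E) ^+ 4).
  have d0 : 0 <= d by rewrite /d; have g1 := ltW g0; nonneg_sum.
  have hl : l * (1 + c - c * E) <= (1 + c) *
      ((1 - u) * (1 + c - c * E) + (c + nu) * ((1 + c) * E * (1 + c * u))).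
    rewrite /l -mulrA; apply: ler_wpM2l; first exact: ltW.
    rewrite mulrDl lerD2l -mulrA; apply: ler_wpM2l => //; lra.
  have hd : d / 16 <= (1 + c - c * E) * (t - l).
    rewrite [leRHS]mulrC mulrBl.
    apply: (@le_trans _ _ (t * (1 + c - c * E) - (1 + c) *
      ((1 - u) * (1 + c - c * E) + (c + nu) * ((1 + c) * E * (1 + c * u))))); last by lra.
    have -> : t * (1 + c - c * E) - (1 + c) *
      ((1 - u) * (1 + c - c * E) + (c + nu) * ((1 + c) * E * (1 + c * u))) =
      (1 - 2 * nu) * ((1 + c * u) * (1 + c * E) *
    ((1 + c) * (1 + E) - (u + E) * (1 + c * (u + E))) * (1 + c - c * E) -
    (1 + c) * ((1 - u) * (1 + c - c * E) + c * ((1 + c) * E * (1 + c * u)))) +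
      (2 * nu) * ((1 + c * u) * (1 + c * E) *
    ((1 + c) * (1 + E) - (u + E - E / 2) * (1 + c * (u + E))) * (1 + c - c * E) -
    (1 + c) * ((1 - u) * (1 + c - c * E) + (c + 2^-1) * ((1 + c) * E * (1 + c * u)))).
      by rewrite /t; field.
    move: h0 h1; rewrite -/d.
    set P := (_ - _); set Q := (X in _ -> _ <= _ * X -> _) => h0 h1.
    have n2 : 0 <= 1 - 2 * nu by lra.
    have n3 : 0 <= 2 * nu by lra.
    have k0 := ler_wpM2l n2 h0; have k1 := ler_wpM2l n3 h1.
    have k2 := mulr_ge0 n2 d0.
    by rewrite -/Q; clear -k0 k1 k2; clearbody d P Q; nra.
  split; first by apply: (@ler_by_slack _ _ _ _ _ rE _ hd); rewrite divr_ge0.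
  move=> cp up; apply: (@ltr_by_slack _ _ _ _ _ rE _ hd).
  by rewrite divr_gt0 // /d !mulr_gt0 ?exprn_gt0.
have K' := ltW K.
have h0 := large_slack_0 c0 u0 E0 uE' K'.
have h1 := large_slack_half c0 u0 E0 uE' K'.
have Ep : 0 < E.
  rewrite lt_neqAle E0 andbT eq_sym; apply/eqP => E00; move: K.
  by rewrite E00 !(mulr0, mul0r, subr0) pmulr_llt0 // ; lra.
have hl : l <= (1 - u) * (1 + c + (c + nu)).
  rewrite /l; nra.
have hd : (1 - 2 * nu) * (c ^+ 2 * E ^+ 4) / 2 + 2 * nu * (c ^+ 3 * E ^+ 4) / 2
    <= (1 + c) ^+ 2 * (t - l).
  apply: (@le_trans _ _ ((1 + c) ^+ 2 * (t - (1 - u) * (1 + c + (c + nu))))); last first.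
    by rewrite ler_pM2l ?exprn_gt0 //; lra.
  have -> : t - (1 - u) * (1 + c + (c + nu)) =
      (1 - 2 * nu) * ((1 + c * u) * (1 + c * E) *
    ((1 + c) * (1 + E) - (u + E) * (1 + c * (u + E))) - (1 - u) * (1 + c + c)) +
      (2 * nu) * ((1 + c * u) * (1 + c * E) *
    ((1 + c) * (1 + E) - (u + E - E / 2) * (1 + c * (u + E))) - (1 - u) * (1 + c + (c + 2^-1))).
    by rewrite /t; field.
  move: h0 h1; set P := (_ - (1 - u) * (1 + c + c)).
  set Q := (_ - (1 - u) * (1 + c + (c + 2^-1))).
  move: (1 + c) (c ^+ 2 * E ^+ 4) (c ^+ 3 * E ^+ 4) => r a b h0 h1.
  have n2 : 0 <= 1 - 2 * nu by lra.
  have n3 : 0 <= 2 * nu by lra.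
  have k0 := ler_wpM2l n2 h0. have k1 := ler_wpM2l n3 h1.
  nra.
have r2 : 0 < (1 + c) ^+ 2 by rewrite exprn_gt0.
have n2 : 0 <= 1 - 2 * nu by lra.
have n3 : 0 <= 2 * nu by lra.
split.
  by apply: (@ler_by_slack _ _ _ _ _ r2 _ hd); rewrite addr_ge0 // !mulr_ge0 ?exprn_ge0 ?invr_ge0.
move=> cp _; apply: (@ltr_by_slack _ _ _ _ _ r2 _ hd).
have a0 : 0 < c ^+ 2 * E ^+ 4 by rewrite mulr_gt0 ?exprn_gt0.
have b0 : 0 < c ^+ 3 * E ^+ 4 by rewrite mulr_gt0 ?exprn_gt0.
have [->|n0] := eqVneq nu 0; first by lra.
have n4 : 0 < nu by rewrite lt0r n0.
rewrite ltr_wpDl ?mulr_gt0 ?mulr_ge0 //; lra.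
Qed.

Lemma vertex_bound_full (R : realFieldType) (c nu u E W : R) :
  0 <= c -> 0 <= nu -> 0 <= u -> u <= 1 -> 1 <= u + E -> 0 <= W -> (1 + c) * W <= 1 - u ->
  let t := (1 + c * u) * (1 + c * E) * (1 - u + nu * E) in
  let l := 1 - u + (c + nu) * W in
  l <= t /\ (0 < c -> u < 1 -> l < t).
Proof.
move=> c0 nu0 u0 u1 uE W0 hW t l.
have c1 : 0 < 1 + c by lra.
have q : 1 + c <= (1 + c * u) * (1 + c * E).
  apply: (@le_trans _ _ ((1 + c * u) * (1 + c * (1 - u)))).
    have : 0 <= c ^+ 2 * (u * (1 - u)) by rewrite !mulr_ge0 ?exprn_ge0 ?subr_ge0.
    lra.
  by rewrite ler_wpM2l ?addr_ge0 ?mulr_ge0 // lerD2l ler_wpM2l //; lra.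
have q1 : (1 - u) * (1 + nu) <= 1 - u + nu * E.
  by rewrite mulrDr mulr1 lerD2l mulrC ler_wpM2l //; lra.
have v0 : 0 <= 1 - u by lra.
have ht : (1 + c) * ((1 - u) * (1 + nu)) <= t.
  by rewrite /t; apply: ler_pM => //; [exact: ltW | rewrite mulr_ge0 // addr_ge0].
have hl : (1 + c) * l <= (1 - u) * (1 + c + c + nu) by rewrite /l; nra.
have hh : (1 + c) * l + c ^+ 2 * (1 - u) <= (1 + c) * t.
  have : (1 + c) * ((1 + c) * ((1 - u) * (1 + nu))) <= (1 + c) * t by rewrite ler_pM2l.
  have : 0 <= (1 - u) * (nu * (c * (2 + c))) by rewrite !mulr_ge0 // addr_ge0.
  lra.
split=> [|cp up]; first by rewrite -(ler_pM2l c1) (le_trans _ hh) // lerDl mulr_ge0 ?exprn_ge0.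
rewrite -(ltr_pM2l c1); apply: lt_le_trans hh.
by rewrite ltrDl mulr_gt0 ?exprn_gt0 ?subr_gt0.
Qed.

Lemma pair_bound (R : realFieldType) (c u v W Z : R) :
  0 <= c -> 0 <= u -> 0 <= v -> u + v < 1 -> 0 <= W -> 0 <= Z ->
  W * (1 + c - c * v) <= (1 + c) * v * (1 + c * u) -> (1 + c) * W <= 1 - u ->
  Z * (1 + c - c * u) <= u * (1 + c * v) ->
  let t := (1 + c * u) * (1 + c * v) in
  let l := (1 - u + (1 + c) * W) * (1 - v + Z) in
  l <= t /\ (0 < c -> 0 < u + v -> l < t).
Proof.
move=> c0 u0 v0 uv W0 Z0 hW1 hW2 hZ t l.
have ru : 0 < 1 + c - c * u by nra.
have rv : 0 < 1 + c - c * v by nra.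
have c1 : 0 < 1 + c by lra.
have uv' : u + v <= 1 by lra.
have hn : (1 - v + Z) * (1 + c - c * u) <= (1 - v) * (1 + c - c * u) + u * (1 + c * v).
  by rewrite mulrDl lerD2l.
have n0 : 0 <= 1 - v + Z by lra.
have m0 : 0 <= 1 - u + (1 + c) * W by nra.
have pw (k : nat) : 0 < u + v -> 0 < v ^+ k.+1 + u ^+ k.+1.
  move=> h; have [v00|vp] := eqVneq v 0.
    by rewrite v00 expr0n add0r exprn_gt0 //; lra.
  by rewrite ltr_pwDl ?exprn_ge0 ?exprn_gt0 // lt0r vp.
have pw0 (k : nat) : 0 <= v ^+ k.+1 + u ^+ k.+1 by rewrite addr_ge0 ?exprn_ge0.
have [K|K] := leP ((1 + c) ^+ 2 * v * (1 + c * u)) ((1 - u) * (1 + c - c * v)).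
  have h := pair_small_slack c0 u0 v0 uv' K.
  have hm : (1 - u + (1 + c) * W) * (1 + c - c * v) <=
      (1 - u) * (1 + c - c * v) + (1 + c) ^+ 2 * v * (1 + c * u).
    by rewrite mulrDl lerD2l; nra.
  have hl : l * ((1 + c - c * v) * (1 + c - c * u)) <= ((1 - u) * (1 + c - c * v) +
      (1 + c) ^+ 2 * v * (1 + c * u)) * ((1 - v) * (1 + c - c * u) + u * (1 + c * v)).
    rewrite /l mulrACA; apply: ler_pM => //; apply: mulr_ge0 => //; exact: ltW.
  have hd : c ^+ 2 * (v ^+ 4 + u ^+ 4) <=
      3 * ((1 + c - c * v) * (1 + c - c * u)) * (t - l).
    apply: (le_trans h); rewrite -[leRHS]mulrA ler_pM2l // mulrBr /t; lra.
  have r0 : 0 < 3 * ((1 + c - c * v) * (1 + c - c * u)) by rewrite !mulr_gt0.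
  split; first by apply: (@ler_by_slack _ _ _ _ _ r0 _ hd); rewrite mulr_ge0 ?sqr_ge0.
  by move=> cp up; apply: (@ltr_by_slack _ _ _ _ _ r0 _ hd); rewrite mulr_gt0 ?exprn_gt0 ?pw.
have h := pair_large_slack c0 u0 v0 uv' (ltW K).
have hm : 1 - u + (1 + c) * W <= 2 * (1 - u) by lra.
have hl : l * (1 + c - c * u) <= 2 * (1 - u) * ((1 - v) * (1 + c - c * u) + u * (1 + c * v)).
  by rewrite /l -mulrA; apply: ler_pM => //; apply: mulr_ge0 => //; exact: ltW.
have hd : c ^+ 2 * (v ^+ 3 + u ^+ 3) <= 2 * (1 + c) * (1 + c - c * u) * (t - l).
  apply: (le_trans h); rewrite -[leRHS]mulrA ler_pM2l ?mulr_gt0 // mulrBr /t; lra.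
have r0 : 0 < 2 * (1 + c) * (1 + c - c * u) by rewrite !mulr_gt0.
split; first by apply: (@ler_by_slack _ _ _ _ _ r0 _ hd); rewrite mulr_ge0 ?sqr_ge0.
by move=> cp up; apply: (@ltr_by_slack _ _ _ _ _ r0 _ hd); rewrite mulr_gt0 ?exprn_gt0 ?pw.
Qed.

Lemma prod1D_ge_sum (R : realFieldType) (I : finType) (P : pred I) (z : I -> R) :
  (forall i, P i -> 0 <= z i) -> 1 + \sum_(i | P i) z i <= \prod_(i | P i) (1 + z i).
Proof.
move=> z0; suff [] : 1 + \sum_(i | P i) z i <= \prod_(i | P i) (1 + z i) /\
  0 <= \sum_(i | P i) z i by [].
elim/big_rec2: _ => [|i p s Pi [h s0]]; first by rewrite addr0.
have zi := z0 i Pi; split; last exact: addr_ge0.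
apply: (@le_trans _ _ ((1 + z i) * (1 + p))); last by rewrite ler_wpM2l // addr_ge0.
have := mulr_ge0 zi s0; lra.
Qed.

Lemma prod_le1_sum (R : realFieldType) (I : finType) (E : I -> R) :
  (0 < #|I|)%N -> (forall i, 0 <= E i) -> \sum_i E i = #|I|%:R -> \prod_i E i <= 1.
Proof.
move=> I0 E0 sE; have /= := @leif_AGM R I predT E (fun i _ => E0 i).
rewrite sE mulfV ?pnatr_eq0 -?lt0n // expr1n; exact.
Qed.

Lemma prod_split_le (R : realFieldType) (a A B B' D Q : R) :
  0 < A -> 0 < B -> B <= B' -> 0 <= Q -> D * Q <= 1 ->
  (a <= A * B * D -> a * Q <= A * B') /\ (a < A * B * D -> a * Q < A * B').
Proof.
move=> A0 B0 BB Q0 DQ.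
have AB : A * B <= A * B' by rewrite ler_pM2l.
have ABp : 0 < A * B by rewrite mulr_gt0.
have h : A * B * D * Q <= A * B by rewrite -mulrA ger_pMr.
split=> ha; first by rewrite (le_trans _ AB) // (le_trans _ h) // ler_wpM2r.
have [->|Qn] := eqVneq Q 0; first by rewrite mulr0 (lt_le_trans _ AB).
by rewrite (lt_le_trans _ AB) // (lt_le_trans _ h) // ltr_pM2r // lt0r Qn.
Qed.

(* Here [s i] stands for k(x_i) = (1 - x_i) / (1 + c x_i) and [z i] for
   (1 + c (s i)) y_i; the weights are those of a vertex of the parameter simplex. *)
Lemma vertex_prod (R : realFieldType) (I : finType) (N : nat) (j : I) (c : R)
    (s z : I -> R) (S := \sum_i s i)
    (b := fun i => if i == j then (1 + c) * (c + N%:R^-1) else N%:R^-1) :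
  #|I| = N.+1 -> (0 < N)%N -> 0 <= c ->
  (forall i, 0 <= s i < 1) -> (forall i, 0 <= z i) ->
  (forall i, (1 + c) ^+ 2 * z i <= 1 - s i) ->
  (forall i, z i * (1 + c - c * (S - s i)) <= (S - s i) * (1 + c * s i)) ->
  \prod_i (1 - s i + b i * z i) <= \prod_i (1 + c * s i) /\
  (0 < c -> 0 < S -> \prod_i (1 - s i + b i * z i) < \prod_i (1 + c * s i)).
Proof.
move=> cI N0 c0 s01 z0 hz1 hz2.
have s0 i : 0 <= s i by case/andP: (s01 i).
have s1 i : s i < 1 by case/andP: (s01 i).
have I0 : (0 < #|I|)%N by rewrite cI.
pose nu : R := N%:R^-1.
have nu0 : 0 < nu by rewrite invr_gt0 ltr0n.
have Nnu : N%:R * nu = 1 by rewrite mulfV // pnatr_eq0 -lt0n.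
have c1 : 0 < 1 + c by lra.
pose u := s j; pose E := \sum_(i | i != j) s i.
have E0 : 0 <= E by apply: sumr_ge0.
have SE : S = u + E by rewrite /S (bigD1 j).
have cN : \sum_(i | i != j) (1 : R) = N%:R.
  by rewrite sumr_const; have := cardC1 j; rewrite cI /= => ->.
have pD (G : I -> R) : \prod_i G i = G j * \prod_(i | i != j) G i by rewrite (bigD1 j).
rewrite !pD /b eqxx.
rewrite (eq_bigr (fun i => 1 - s i + nu * z i)); last by move=> i /negbTE ->.
rewrite -/nu -/u.
set Q := \prod_(i | i != j) (1 - s i + nu * z i).
have q0 i : 0 <= 1 - s i + nu * z i.
  by rewrite addr_ge0 // ?mulr_ge0 // ?subr_ge0 ltW.
have Q0 : 0 <= Q by apply: prodr_ge0.
have hB : 1 + c * E <= \prod_(i | i != j) (1 + c * s i).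
  by rewrite /E mulr_sumr; apply: prod1D_ge_sum => i _; apply: mulr_ge0.
have u1 : u < 1 := s1 j.
have u0 : 0 <= u := s0 j.
have A0 : 0 < 1 + c * u by rewrite ltr_wpDr // mulr_ge0.
have B0 : 0 < 1 + c * E by rewrite ltr_wpDr // mulr_ge0.
pose W := (1 + c) * z j.
have W0 : 0 <= W by rewrite mulr_ge0 // ltW.
have hW : (1 + c) * W <= 1 - u by rewrite /W mulrA -expr2.
have -> : (1 + c) * (c + nu) * z j = (c + nu) * W by rewrite /W; ring.
(* Spreads the excess over the factors [i != j] by AM-GM. *)
have agm (D : R) (l : R) : 0 <= D -> D = 1 + E - l * (S - nu * E) ->
    (forall i, i != j -> z i <= l * (S - s i)) -> D * Q <= 1.
  move=> D0 eD hl.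
  pose e i := if i == j then D else 1 - s i + nu * (l * (S - s i)).
  have e0 i : 0 <= e i.
    rewrite /e; case: ifPn => // ij.
    by apply: le_trans (q0 i) _; rewrite lerD2l ler_pM2l // hl.
  have se : \sum_i e i = #|I|%:R.
    rewrite (bigD1 j) //= {1}/e eqxx.
    rewrite (eq_bigr (fun i => 1 - s i + (nu * l * S - nu * l * s i))); last first.
      by move=> i /negbTE ij; rewrite /e ij; ring.
    rewrite big_split /= !sumrB cN.
    have -> : \sum_(i | i != j) nu * l * S = N%:R * (nu * l * S).
      by rewrite -cN mulr_suml; apply: eq_bigr => i _; rewrite mul1r.
    rewrite -mulr_sumr -/E eD cI -natr1 !mulrA Nnu; ring.
  apply: le_trans (prod_le1_sum I0 e0 se).
  rewrite (bigD1 j) //= {1}/e eqxx ler_wpM2l //.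
  apply: ler_prod => i ij; rewrite q0 /= /e (negbTE ij) lerD2l ler_pM2l //.
  exact: hl.
have Su : S - u = E by rewrite SE; ring.
have hWE : W * (1 + c - c * E) <= (1 + c) * E * (1 + c * u).
  by rewrite /W -!mulrA ler_pM2l // -Su; exact: hz2.
have [S1|S1] := ltP S 1; last first.
  have hz i : i != j -> z i <= 1 * (S - s i).
    move=> _; rewrite mul1r; apply: (@le_trans _ _ (1 - s i)); last by rewrite lerD2r.
    by apply: le_trans (hz1 i); rewrite ler_peMl ?exprn_ege1 ?lerDl.
  rewrite SE in S1.
  have [h1 h2] := vertex_bound_full c0 (ltW nu0) u0 (ltW u1) S1 W0 hW.
  have D0 : 0 <= 1 - u + nu * E by rewrite addr_ge0 ?subr_ge0 ?mulr_ge0 // ltW.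
  have DQ : (1 - u + nu * E) * Q <= 1.
    by apply: (agm _ 1) => //; rewrite SE; ring.
  have [k1 k2] := prod_split_le (1 - u + (c + nu) * W) A0 B0 hB Q0 DQ.
  by split=> [|cp _]; [apply: k1 | apply/k2/h2].
rewrite SE in S1.
have := N0; rewrite leq_eqVlt => /predU1P[N1|N2].
  have nu1 : nu = 1 by rewrite /nu -N1 invr1.
  have /mem_card1[k hk] : #|predC1 j| = 1%N by have := cardC1 j; rewrite cI -N1.
  have pk (G : I -> R) : \prod_(i | i != j) G i = G k.
    by rewrite (eq_bigl (pred1 k)) ?big_pred1_eq.
  have kE : E = s k by rewrite /E (eq_bigl (pred1 k)) ?big_pred1_eq.
  rewrite /Q !pk nu1 mul1r [c + 1]addrC.
  rewrite kE in S1 hWE SE.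
  have hZ : z k * (1 + c - c * u) <= u * (1 + c * s k).
    by have := hz2 k; rewrite SE addrK.
  have [h1 h2] := pair_bound c0 u0 (s0 k) S1 W0 (z0 k) hWE hW hZ.
  by rewrite SE; split=> [|cp up]; [apply: h1|apply: h2].
pose l := (1 + c * (u + E)) / (1 + c).
have nu2 : nu <= 2^-1 by rewrite lef_pV2 ?posrE ?ltr0n // ler_nat.
have [h1 h2] := vertex_bound c0 (ltW nu0) nu2 u0 E0 S1 hWE hW.
pose D := 1 + E - l * (S - nu * E).
have cD : (1 + c) * D = (1 + c) * (1 + E) - (u + E - nu * E) * (1 + c * (u + E)).
  by rewrite /D /l SE; field; exact: lt0r_neq0.
have D0 : 0 <= D.
  rewrite -(pmulr_rge0 _ c1) cD.
  have : (u + E - nu * E) * (1 + c * (u + E)) <= (u + E) * (1 + c); last first.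
    have : 0 <= (1 + c) * (1 - u) by apply: mulr_ge0; lra.
    lra.
  have nE : nu * E <= u + E.
    by apply: (@le_trans _ _ E); rewrite ?lerDr // ler_piMl //; lra.
  have nE0 : 0 <= nu * E by rewrite mulr_ge0 // ltW.
  have uE0 : 0 <= u + E by rewrite addr_ge0.
  apply: ler_pM; rewrite ?subr_ge0 ?gerBl //; first by rewrite addr_ge0 ?mulr_ge0.
  by rewrite lerD2l ler_piMr // ltW.
have hz i : i != j -> z i <= l * (S - s i).
  move=> _; set e := S - s i.
  have e0 : 0 <= e by rewrite subr_ge0 /S (bigD1 i) //= lerDl sumr_ge0.
  have eS : e <= u + E by rewrite /e SE gerBl.
  have den : 0 < 1 + c - c * e by nra.
  rewrite /l mulrAC ler_pdivlMr // -(ler_pM2r den).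
  apply: (@le_trans _ _ (e * (1 + c * s i) * (1 + c))).
    by rewrite mulrAC ler_pM2r //; exact: hz2.
  rewrite [(1 + c * (u + E)) * e]mulrC -!mulrA ler_wpM2l // -SE.
  have -> : s i = S - e by rewrite /e; ring.
  have : 0 <= c * (c * ((1 - S) * e)) by rewrite !mulr_ge0 // subr_ge0 SE ltW.
  lra.
have DQ : D * Q <= 1 by apply: (agm _ l).
have [k1 k2] := prod_split_le (1 - u + (c + nu) * W) A0 B0 hB Q0 DQ.
have eD : (1 + c) * ((1 + c * u) * (1 + c * E) * D) =
    (1 + c * u) * (1 + c * E) * ((1 + c) * (1 + E) - (u + E - nu * E) * (1 + c * (u + E))).
  by rewrite -cD; ring.
split=> [|cp]; first by apply: k1; rewrite -(ler_pM2l c1) eD.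
by rewrite SE => up; apply: k2; rewrite -(ltr_pM2l c1) eD; apply: h2.
Qed.

Lemma spread_inverses (R : realFieldType) (x1 x2 w1 w2 p q n l : R) :
  0 <= x1 -> 0 <= x2 -> 0 <= w1 -> 0 <= w2 ->
  0 < l -> p + q = n + l -> p <= n -> q <= n ->
  (x1 + w1 / p) * (x2 + w2 / q) <= (x1 + w1 / n) * (x2 + w2 / l) \/
  (x1 + w1 / p) * (x2 + w2 / q) <= (x1 + w1 / l) * (x2 + w2 / n).
Proof.
move=> x10 x20 w10 w20 l0 pq pn qn.
have p0 : 0 < p by lra.
have q0 : 0 < q by lra.
have n0 : 0 < n by lra.
have nl : n * l <= p * q by nra.
have hpq : p^-1 * q^-1 <= n^-1 * l^-1.
  by rewrite -!invfM lef_pV2 ?posrE ?mulr_gt0.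
have hs : p^-1 + q^-1 <= n^-1 + l^-1.
  have -> : p^-1 + q^-1 = (n + l) * (p^-1 * q^-1).
    by rewrite -pq; field; rewrite !lt0r_neq0.
  have -> : n^-1 + l^-1 = (n + l) * (n^-1 * l^-1).
    by field; rewrite !lt0r_neq0.
  by rewrite ler_wpM2l // addr_ge0 // ltW.
have hq : q^-1 <= l^-1 by rewrite lef_pV2 ?posrE //; lra.
have hp : p^-1 <= l^-1 by rewrite lef_pV2 ?posrE //; lra.
have ww := mulr_ge0 w10 w20.
have h := ler_wpM2l ww hpq.
have a0 : 0 <= w1 * x2 by exact: mulr_ge0.
have b0 : 0 <= w2 * x1 by exact: mulr_ge0.
have [ab|/ltW ab] := leP (w1 * x2) (w2 * x1); [left|right].
  have k := ler_wpM2l a0 hs.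
  have k' : (w2 * x1 - w1 * x2) * q^-1 <= (w2 * x1 - w1 * x2) * l^-1.
    by rewrite ler_wpM2l // subr_ge0.
  lra.
have k := ler_wpM2l b0 hs.
have k' : (w1 * x2 - w2 * x1) * p^-1 <= (w1 * x2 - w2 * x1) * l^-1.
  by rewrite ler_wpM2l // subr_ge0.
lra.
Qed.

(* The logarithm of each factor is convex in [a i], so the product over the
   simplex is largest at a vertex. *)
Lemma simplex_vertex_le (R : realFieldType) (I : finType) (m : R) (x w a : I -> R) :
  (0 < #|I|)%N -> 0 < m -> (forall i, 0 <= x i) -> (forall i, 0 <= w i) ->
  (forall i, m <= a i < 1) -> \sum_i a i = 1 ->
  exists j, \prod_i (x i + w i / (1 - a i)) <=
    \prod_i (x i + w i / (1 - (if i == j then 1 - #|I|.-1%:R * m else m))).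
Proof.
move=> I0 m0 x0 w0.
move: {2}#|_| (leqnn #|[pred i | a i != m]|) => k.
have vertex (b : I -> R) j : (forall i, i != j -> b i = m) -> \sum_i b i = 1 ->
    \prod_i (x i + w i / (1 - b i)) =
    \prod_i (x i + w i / (1 - (if i == j then 1 - #|I|.-1%:R * m else m))).
  move=> bm sb; apply: eq_bigr => i _; case: ifPn => [/eqP->|/bm -> //].
  suff -> : b j = 1 - #|I|.-1%:R * m by [].
  move: sb; rewrite (bigD1 j) //= (eq_bigr (fun=> m)) // sumr_const.
  have /= -> := cardC1 j; rewrite -[m *+ _]mulr_natl => h.
  by apply/eqP; rewrite eq_sym subr_eq h.
elim: k a => [|k IH] a hk am sa.
  have am0 i : a i = m.
    move: hk; rewrite leqn0 => /eqP/card0_eq/(_ i); rewrite inE.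
    by move/negbT; rewrite negbK => /eqP.
  by have /card_gt0P[j _] := I0; exists j; rewrite (vertex _ j).
have [i ai|am0] := pickP [pred i | a i != m]; last first.
  have /card_gt0P[j _] := I0; exists j; rewrite (vertex _ j) // => i _.
  by apply/eqP; move: (am0 i) => /= /negbT; rewrite negbK.
have [j /andP[ji aj]|am0] := pickP [pred j | (j != i) && (a j != m)]; last first.
  exists i; rewrite (vertex _ i) // => l li.
  by apply/eqP; move: (am0 l) => /=; rewrite li => /negbT; rewrite negbK.
have ml l : m <= a l by case/andP: (am l).
have l1 l : a l < 1 by case/andP: (am l).
have pD (G : I -> R) : \prod_l G l =
    G i * (G j * \prod_(l | (l != i) && (l != j)) G l).
  by rewrite (bigD1 i) // (bigD1 j).
have sD (G : I -> R) : \sum_l G l =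
    G i + (G j + \sum_(l | (l != i) && (l != j)) G l).
  by rewrite (bigD1 i) // (bigD1 j).
have a0 l : 0 <= a l by exact: le_trans (ltW m0) (ml l).
have aij : a i + a j <= 1 by rewrite -sa sD addrA lerDl sumr_ge0.
pose spread i1 j1 l := if l == i1 then m else if l == j1 then a i + a j - m else a l.
have hspread i1 j1 : i1 != j1 -> i1 \in pred2 i j -> j1 \in pred2 i j ->
    exists v, \prod_l (x l + w l / (1 - spread i1 j1 l)) <=
    \prod_l (x l + w l / (1 - (if l == v then 1 - #|I|.-1%:R * m else m))).
  move=> ij1 i1ij j1ij; apply: IH.
  - rewrite -ltnS; apply: leq_trans hk; apply: proper_card; apply/properP; split.
      apply/subsetP => l; rewrite !inE /spread; case: (l == i1); first by rewrite eqxx.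
      have [->|//] := eqVneq l j1 => _; move: j1ij; rewrite !inE.
      by case/orP => /eqP ->.
    exists i1; rewrite inE ?/spread ?eqxx //.
    by move: i1ij; rewrite !inE => /orP[] /eqP ->.
  - move=> l; rewrite /spread; case: ifP => _; first by rewrite lexx (le_lt_trans (ml i)).
    case: ifP => _; last exact: am.
    apply/andP; split; first by rewrite lerBrDr lerD.
    by rewrite ltrBlDr (le_lt_trans aij) // ltrDl.
  - rewrite -sa !sD; have e l : l != i -> l != j -> spread i1 j1 l = a l.
      move=> li lj; rewrite /spread; move: i1ij j1ij; rewrite !inE.
      by do 2![case/orP=> /eqP ->]; rewrite ?(negbTE li) ?(negbTE lj).
    rewrite (eq_bigr a); last by move=> l /andP[]; exact: e.
    move: i1ij j1ij ij1; rewrite !inE /spread => /orP[] /eqP -> /orP[] /eqP ->;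
      rewrite ?eqxx // ?(negbTE ji) ?[i == j]eq_sym ?(negbTE ji) ?eqxx => _; ring.
have pos l b : b < 1 -> 0 <= x l + w l / (1 - b).
  by move=> b1; rewrite addr_ge0 // divr_ge0 // subr_ge0 ltW.
pose P := \prod_(l | (l != i) && (l != j)) (x l + w l / (1 - a l)).
have P0 : 0 <= P by apply: prodr_ge0 => l _; apply: pos.
have eP i1 j1 : i1 \in pred2 i j -> j1 \in pred2 i j ->
    \prod_(l | (l != i) && (l != j)) (x l + w l / (1 - spread i1 j1 l)) = P.
  move=> h1 h2; apply: eq_bigr => l /andP[li lj]; rewrite /spread.
  move: h1 h2; rewrite !inE.
  by do 2![case/orP=> /eqP ->]; rewrite ?(negbTE li) ?(negbTE lj).
have ij : i != j by rewrite eq_sym.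
have Lgt : 0 < 1 - (a i + a j - m) by lra.
have [h|h] := spread_inverses (x0 i) (x0 j) (w0 i) (w0 j) Lgt
  (p := 1 - a i) (q := 1 - a j) (n := 1 - m) ltac:(ring)
  ltac:(rewrite lerD2l lerN2; exact: ml) ltac:(rewrite lerD2l lerN2; exact: ml).
  have [|||v hv] := hspread i j; rewrite ?inE ?eqxx ?orbT //.
  exists v; apply: le_trans hv; rewrite !pD eP ?inE ?eqxx ?orbT // -/P.
  by rewrite {1}/spread {1}/spread eqxx (negbTE ji) eqxx !mulrA ler_wpM2r.
have [|||v hv] := hspread j i; rewrite ?inE ?eqxx ?orbT //.
exists v; apply: le_trans hv; rewrite !pD eP ?inE ?eqxx ?orbT // -/P.
by rewrite {1}/spread {1}/spread (negbTE ij) !eqxx !mulrA ler_wpM2r.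
Qed.

Lemma corner_bound (R : realFieldType) (I : finType) (N : nat) (c : R)
    (a s y : I -> R) (S := \sum_i s i) (x := fun i => (1 - s i) / (1 + c * s i)) :
  #|I| = N.+1 -> (0 < N)%N -> 0 <= c -> \sum_i a i = 1 ->
  (forall i, (1 + N%:R * (1 + c))^-1 <= a i < 1) ->
  (forall i, 0 <= s i < 1) -> (forall i, 0 <= y i) ->
  (forall i, (1 + c) ^+ 2 * y i <= x i) ->
  (forall i, y i * (1 + c - c * (S - s i)) <= S - s i) ->
  let p := \prod_i (x i + (1 + c) * (a i / (1 - a i)) * y i) in
  p <= 1 /\ (0 < c -> 0 < S -> p < 1).
Proof.
move=> cI N0 c0 sa ma s01 y0 yx yT p.
pose m : R := (1 + N%:R * (1 + c))^-1.
have c1 : 0 < 1 + c by lra.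
have n0 : 0 < N%:R :> R by rewrite ltr0n.
have d0 : 0 < 1 + N%:R * (1 + c) by rewrite addr_gt0 // mulr_gt0.
have m0 : 0 < m by rewrite invr_gt0.
have I0 : (0 < #|I|)%N by rewrite cI.
have cs i : 0 < 1 + c * s i by case/andP: (s01 i) => s0 _; rewrite ltr_wpDr // mulr_ge0.
have x0 i : 0 <= x i - (1 + c) * y i.
  rewrite subr_ge0; apply: le_trans (yx i); rewrite expr2 -mulrA ler_peMl ?lerDl //.
  by rewrite mulr_ge0 // ltW.
have w0 i : 0 <= (1 + c) * y i by rewrite mulr_ge0 // ltW.
have [j hj] := simplex_vertex_le I0 m0 x0 w0 ma sa.
pose b i : R := if i == j then (1 + c) * (c + N%:R^-1) else N%:R^-1.
have hp : p = \prod_i (x i - (1 + c) * y i + (1 + c) * y i / (1 - a i)).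
  apply: eq_bigr => i _; have /andP[_ ai] := ma i.
  have : 1 - a i != 0 by rewrite subr_eq0 gt_eqF.
  by move=> h; field.
have hv : \prod_i (x i - (1 + c) * y i + (1 + c) * y i /
    (1 - (if i == j then 1 - #|I|.-1%:R * m else m))) =
    \prod_i ((1 - s i + b i * ((1 + c * s i) * y i)) / (1 + c * s i)).
  apply: eq_bigr => i _; rewrite /b /x cI /= /m; case: ifP => _.
    by field; rewrite !lt0r_neq0.
  have -> : 1 - (1 + N%:R * (1 + c))^-1 = N%:R * (1 + c) / (1 + N%:R * (1 + c)).
    by field; rewrite lt0r_neq0.
  by field; rewrite !lt0r_neq0.
rewrite hv prodf_div in hj.
have pc : 0 < \prod_i (1 + c * s i) by apply: prodr_gt0.
have z0 i : 0 <= (1 + c * s i) * y i by rewrite mulr_ge0 // ltW.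
have hz1 i : (1 + c) ^+ 2 * ((1 + c * s i) * y i) <= 1 - s i.
  by rewrite mulrCA mulrC -ler_pdivlMr //; exact: yx.
have hz2 i : (1 + c * s i) * y i * (1 + c - c * (S - s i)) <= (S - s i) * (1 + c * s i).
  by rewrite -mulrA mulrC ler_wpM2r // ltW.
have [k1 k2] := vertex_prod j cI N0 c0 s01 z0 hz1 hz2.
rewrite hp; split=> [|cp Sp].
  by apply: le_trans hj _; rewrite ler_pdivrMr // mul1r.
by apply: le_lt_trans hj _; rewrite ltr_pdivrMr // mul1r; apply: k2.
Qed.

Lemma balance_ge1 (R : realFieldType) (I : finType) (a : I -> R) (t r : R) :
  (0 < #|I|)%N -> (forall i, 0 < a i < 1) -> \sum_i a i = 1 -> 1 <= t -> t < r ->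
  r * \prod_i (1 + a i * (t - 1)) < t * \prod_i (1 + a i * (r - 1)).
Proof.
move=> /card_gt0P[j _] a01 sa t1 tr.
have a0 i : 0 < a i by case/andP: (a01 i).
have a1 i : a i < 1 by case/andP: (a01 i).
have t0 : 0 < t by lra.
pose z i := a i * (r - t) / t.
have z0 i : 0 < z i by rewrite divr_gt0 // mulr_gt0 // subr_gt0.
have d0 i : 0 < 1 + a i * (t - 1) by rewrite ltr_wpDr // mulr_ge0 ?subr_ge0 // ltW.
have dt i : 1 + a i * (t - 1) <= t.
  by rewrite -lerBrDl ler_piMl ?subr_ge0 // ltW.
have hz i : (1 + a i * (t - 1)) * (1 + z i) <= 1 + a i * (r - 1).
  have : (1 + a i * (t - 1)) * (a i * (r - t) / t) <= a i * (r - t).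
    rewrite mulrCA -[leRHS]mulr1 ler_wpM2l //; last by rewrite ler_pdivrMr ?mul1r.
    by rewrite mulr_ge0 ?subr_ge0 // ltW.
  by rewrite /z; lra.
have sz : \sum_i z i = (r - t) / t by rewrite -!mulr_suml sa mul1r.
have hr : r < t * \prod_i (1 + z i).
  rewrite mulrC -ltr_pdivrMr // (bigD1 j) //=.
  pose Z := \sum_(i | i != j) z i.
  have hZ : 1 + Z <= \prod_(i | i != j) (1 + z i).
    by apply: prod1D_ge_sum => i _; apply: ltW.
  have sZ : z j + Z = (r - t) / t by rewrite -sz (bigD1 j).
  have Z0 : 0 < Z.
    have -> : Z = (1 - a j) * (r - t) / t.
      by move: sZ; rewrite /z => /(canRL (addKr _)) ->; ring.
    by rewrite divr_gt0 // mulr_gt0 // subr_gt0.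
  have e : r / t = 1 + (z j + Z) by rewrite sZ; field; exact: lt0r_neq0.
  apply: (@lt_le_trans _ _ ((1 + z j) * (1 + Z))).
    have := mulr_gt0 (z0 j) Z0; rewrite e; lra.
  by rewrite ler_wpM2l // addr_ge0 // ltW.
have pd : 0 < \prod_i (1 + a i * (t - 1)) by apply: prodr_gt0.
apply: (@lt_le_trans _ _ (t * \prod_i (1 + z i) * \prod_i (1 + a i * (t - 1)))).
  by rewrite ltr_pM2r.
rewrite -mulrA ler_pM2l // mulrC -big_split /=.
by apply: ler_prod => i _; rewrite hz andbT ltW // mulr_gt0 // addr_gt0.
Qed.

Lemma balance_le1 (R : realFieldType) (I : finType) (a : I -> R) (t : R) :
  (forall i, 0 <= a i <= 1) -> \sum_i a i = 1 -> 0 < t -> t <= 1 ->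
  \prod_i (1 + a i * (t - 1)) <= t ^+ 2 * \prod_i (1 + a i * (t^-1 - 1)).
Proof.
move=> a01 sa t0 t1.
pose y := 1 - t; have y0 : 0 <= y by rewrite /y; lra.
pose b := \sum_i a i.
suff : \prod_i (1 + a i * (t - 1)) * (t + b * y) <=
    (1 - b * y) * t * \prod_i (1 + a i * (t^-1 - 1)).
  have -> : t + b * y = 1 by rewrite /b sa /y; ring.
  have -> : 1 - b * y = t by rewrite /b sa /y; ring.
  by rewrite mulr1 expr2.
have : b <= 1 by rewrite /b sa.
rewrite {}/b; set K := (K in K -> _).
suff [] : [/\ 0 <= \sum_i a i, 0 <= \prod_i (1 + a i * (t^-1 - 1)) & (K ->
  \prod_i (1 + a i * (t - 1)) * (t + (\sum_i a i) * y) <=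
  (1 - (\sum_i a i) * y) * t * \prod_i (1 + a i * (t^-1 - 1)))] by [].
rewrite /K; apply: (big_rec3 (fun b p q => [/\ 0 <= b, 0 <= p & (b <= 1 ->
  q * (t + b * y) <= (1 - b * y) * t * p)])) => [|i b p q _ [b0 p0 IH]].
  by split=> // _; rewrite !mul0r subr0 addr0 mul1r mulr1.
have /andP[ai0 ai1] := a01 i.
have e0 : 0 <= t^-1 - 1 by rewrite subr_ge0 invf_ge1.
split; [exact: addr_ge0 | by rewrite mulr_ge0 ?addr_ge0 ?mulr_ge0 |].
move=> ab; have b1 : b <= 1 by lra.
have by0 : b * y <= y by rewrite ler_piMl.
have d0 : 0 < t + b * y by rewrite ltr_wpDr ?mulr_ge0.
have ay : 0 <= 1 + a i * (t - 1).
  have : a i * y <= y by rewrite ler_piMl.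
  by rewrite /y in y0 *; lra.
rewrite -(ler_pM2r d0).
apply: (@le_trans _ _ ((1 + a i * (t - 1)) * (t + (a i + b) * y) * ((1 - b * y) * t * p))).
  rewrite [leLHS](_ : _ = (1 + a i * (t - 1)) * (t + (a i + b) * y) * (q * (t + b * y))); last by ring.
  have ab0 : 0 <= t + (a i + b) * y.
    by rewrite addr_ge0 ?(ltW t0) // mulr_ge0 // addr_ge0.
  by rewrite ler_wpM2l ?IH // mulr_ge0.
have tp : 0 <= t * p by rewrite mulr_ge0 // ltW.
rewrite [leLHS](_ : _ = (1 + a i * (t - 1)) * (t + (a i + b) * y) * (1 - b * y) * (t * p)); last by ring.
rewrite [leRHS](_ : _ = (1 - (a i + b) * y) * (1 + a i * (t^-1 - 1)) * (t + b * y) * (t * p)); last by ring.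
rewrite ler_wpM2r // -(ler_pM2l t0) -subr_ge0.
have -> : t * ((1 - (a i + b) * y) * (1 + a i * (t^-1 - 1)) * (t + b * y)) -
   t * ((1 + a i * (t - 1)) * (t + (a i + b) * y) * (1 - b * y)) =
   a i * b * y ^+ 2 * (y * (1 + t) * (1 - (a i + b))).
  by rewrite /y; field; exact: lt0r_neq0.
by rewrite !mulr_ge0 ?subr_ge0 ?addr_ge0 // ltW.
Qed.

Lemma balance_lt (R : realFieldType) (I : finType) (a : I -> R) (t r : R) :
  (0 < #|I|)%N -> (forall i, 0 < a i < 1) -> \sum_i a i = 1 -> 0 < r -> r^-1 < t -> t < r ->
  r * \prod_i (1 + a i * (t - 1)) < t * \prod_i (1 + a i * (r - 1)).
Proof.
move=> I0 a01 sa r0 rt tr; have [t1|t1] := leP 1 t; first exact: balance_ge1.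
have t0 : 0 < t by apply: lt_trans rt; rewrite invr_gt0.
have tV1 : 1 <= t^-1 by rewrite invf_ge1 // ltW.
have tVr : t^-1 < r by rewrite invf_plt ?posrE.
have h := balance_ge1 I0 a01 sa tV1 tVr.
have a01' i : 0 <= a i <= 1 by case/andP: (a01 i) => *; rewrite !ltW.
have k := balance_le1 a01' sa t0 (ltW t1).
apply: (@le_lt_trans _ _ (t ^+ 2 * (r * \prod_i (1 + a i * (t^-1 - 1))))).
  by rewrite mulrCA ler_pM2l.
rewrite -(ltr_pM2l (exprn_gt0 2 t0)) in h; apply: lt_le_trans h _.
by rewrite mulrA expr2 mulfK ?lt0r_neq0.
Qed.

Definition kappa (R : fieldType) (c s : R) : R := (1 - s) / (1 + c * s).

Lemma kappaK (R : realFieldType) (c s : R) : 0 <= c -> 0 <= s -> s <= 1 ->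
  kappa c (kappa c s) = s.
Proof.
move=> c0 s0 s1; have h : 0 < 1 + c * s by rewrite ltr_wpDr ?mulr_ge0.
have h' : 1 + c * ((1 - s) / (1 + c * s)) != 0.
  by rewrite gt_eqF // ltr_wpDr // !mulr_ge0 ?subr_ge0 // invr_ge0 ltW.
rewrite /kappa; field; rewrite lt0r_neq0 //= lt0r_neq0 //; lra.
Qed.

Lemma kappa_ge0 (R : realFieldType) (c s : R) : 0 <= c -> 0 <= s -> s <= 1 -> 0 <= kappa c s.
Proof.
by move=> c0 s0 s1; rewrite divr_ge0 ?subr_ge0 // addr_ge0 ?mulr_ge0.
Qed.

Lemma kappa_step (R : realFieldType) (c a x y : R) (p := kappa c a) :
  0 <= c -> 0 <= a -> a <= 1 -> 0 <= y -> y <= x -> x <= 1 ->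
  (1 - a) * kappa c x + a * kappa c y <= kappa c (p * x + (1 - p) * y).
Proof.
move=> c0 a0 a1 y0 yx x1.
have hx : 0 < 1 + c * x by rewrite ltr_wpDr // mulr_ge0 // (le_trans y0).
have hy : 0 < 1 + c * y by rewrite ltr_wpDr // mulr_ge0.
have ha : 0 < 1 + c * a by rewrite ltr_wpDr // mulr_ge0.
pose Z := (1 - a) * x + (1 + c) * a * y.
have x0 := le_trans y0 yx.
have Z0 : 0 <= Z by rewrite addr_ge0 ?mulr_ge0 ?subr_ge0 // addr_ge0.
have hZ : 0 < 1 + c * a + c * Z by rewrite ltr_wpDr // mulr_ge0.
have -> : kappa c (p * x + (1 - p) * y) = (1 + c * a - Z) / (1 + c * a + c * Z).
  have -> : p * x + (1 - p) * y = Z / (1 + c * a).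
    by rewrite /p /kappa /Z; field; exact: lt0r_neq0.
  rewrite /kappa; field; rewrite !lt0r_neq0 //=.
have -> : (1 - a) * kappa c x + a * kappa c y =
   ((1 - a) * (1 - x) * (1 + c * y) + a * (1 - y) * (1 + c * x)) / ((1 + c * x) * (1 + c * y)).
  by rewrite /kappa; field; rewrite !lt0r_neq0.
rewrite ler_pdivrMr ?mulr_gt0 // [leRHS]mulrAC ler_pdivlMr // -subr_ge0.
have -> : (1 + c * a - Z) * ((1 + c * x) * (1 + c * y)) -
   ((1 - a) * (1 - x) * (1 + c * y) + a * (1 - y) * (1 + c * x)) * (1 + c * a + c * Z) =
   (1 + c) * (a * (1 - a)) * ((x - y) * (c * (1 - x) + c * ((1 + c) * y))).
  by rewrite /Z; ring.
have c1 : 0 <= 1 + c by rewrite addr_ge0.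
by rewrite !mulr_ge0 ?subr_ge0 // addr_ge0 // !mulr_ge0 ?subr_ge0.
Qed.

Lemma prod_eq_pointwise (R : realFieldType) (I : finType) (f g : I -> R) :
  (forall i, 0 <= f i <= g i) -> 0 < \prod_i f i -> \prod_i f i = \prod_i g i ->
  forall i, f i = g i.
Proof.
move=> fg f0 efg i; have pD (h : I -> R) : \prod_j h j = h i * \prod_(j | j != i) h j.
  by rewrite (bigD1 i).
have /andP[fi0 fgi] := fg i; rewrite !pD in efg f0.
have hp : 0 < \prod_(j | j != i) f j.
  rewrite lt0r prodr_ge0 ?andbT => [|j _]; last by case/andP: (fg j).
  by apply/eqP => h; move: f0; rewrite h mulr0 ltxx.
have hle : \prod_(j | j != i) f j <= \prod_(j | j != i) g j.
  by apply: ler_prod => j _; apply: fg.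
apply/eqP; move: fgi; rewrite le_eqVlt => /orP[//|lt]; exfalso.
suff : f i * \prod_(j | j != i) f j < g i * \prod_(j | j != i) g j by rewrite efg ltxx.
apply: (@lt_le_trans _ _ (g i * \prod_(j | j != i) f j)); first by rewrite ltr_pM2r.
by rewrite ler_wpM2l // (le_trans fi0) // ltW.
Qed.

Lemma scale_exists (R : rcfType) (I : finType) (o : I -> R) :
  (forall i, 0 < o i) -> 1 <= \sum_i (1 + o i)^-1 ->
  exists2 c, 0 <= c & \sum_i (1 + (1 + c) * o i)^-1 = 1.
Proof.
move=> o0 h1.
pose d i : {poly R} := 1 + (o i) *: 'X.
pose P : {poly R} := \prod_i d i - \sum_i \prod_(j | j != i) d j.
have ed i x : (d i).[x] = 1 + x * o i by rewrite !hornerE mulrC.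
have d0 i x : 0 <= x -> 0 < 1 + x * o i by move=> x0; rewrite ltr_wpDr // mulr_ge0 // ltW.
have eP x : 0 <= x -> P.[x] = \prod_i (1 + x * o i) * (1 - \sum_i (1 + x * o i)^-1).
  move=> x0; rewrite hornerD hornerN horner_prod horner_sum mulrBr mulr1 mulr_sumr.
  congr (_ - _); first by apply: eq_bigr => i _; rewrite ed.
  apply: eq_bigr => i _; rewrite horner_prod [in RHS](bigD1 i) //= mulrAC mulfV ?gt_eqF ?d0 //.
  by rewrite mul1r; apply: eq_bigr => j _; rewrite ed.
have pp x : 0 <= x -> 0 < \prod_i (1 + x * o i).
  by move=> x0; apply: prodr_gt0 => i _; apply: d0.
pose M := \sum_i (o i)^-1.
have M1 : 1 <= M.
  apply: le_trans h1 _; apply: ler_sum => i _.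
  by rewrite lef_pV2 ?posrE ?o0 ?lerDr //; have := o0 i; lra.
have M0 : 0 < M by apply: lt_le_trans M1.
have [|x /andP[x1 xM] /eqP rx] := @poly_ivt R P 1 M M1.
  rewrite !eP ?ler01 ?(ltW M0) //; apply/andP; split.
    rewrite mulr_ge0_le0 ?(ltW (pp _ _)) // subr_le0.
    by under eq_bigr do rewrite mul1r.
  rewrite mulr_ge0 ?(ltW (pp _ _)) ?(ltW M0) // subr_ge0.
  apply: (@le_trans _ _ (\sum_i M^-1 * (o i)^-1)).
    2: by rewrite -mulr_sumr mulVf ?gt_eqF.
  apply: ler_sum => i _; rewrite -invfM lef_pV2 ?posrE ?d0 ?mulr_gt0 ?(ltW M0) //.
  by rewrite lerDr.
have x0 : 0 <= x by apply: le_trans x1.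
exists (x - 1); first by rewrite subr_ge0.
move: rx; rewrite eP // => /eqP; rewrite mulf_eq0 gt_eqF ?pp //= subr_eq0 => /eqP e.
by rewrite [RHS]e; apply: eq_bigr => i _; rewrite [1 + (x - 1)]addrC subrK.
Qed.

Lemma product_step (R : realFieldType) (I : finType) (N : nat) (c : R)
    (a x y : I -> R) (p := fun i => kappa c (a i)) (P := \prod_i p i) :
  #|I| = N.+1 -> (0 < N)%N -> 0 <= c -> \sum_i a i = 1 ->
  (forall i, (1 + N%:R * (1 + c))^-1 <= a i < 1) ->
  (forall i, 0 <= y i) -> (forall i, y i <= x i) -> (forall i, x i <= 1) ->
  (forall i, y i * \prod_(j | j != i) x j <= P) ->
  (forall i, 1 <= kappa c (y i) + \sum_(j | j != i) kappa c (x j)) ->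
  let Z := \prod_i (p i * x i + (1 - p i) * y i) in
  Z <= P /\ (0 < c -> Z = P -> (forall i, x i = y i) \/ (forall i, x i = 1 /\ y i = 0)).
Proof.
move=> cI N0 c0 sa ma y0 yx x1 hP hT Z.
have n0 : 0 < N%:R :> R by rewrite ltr0n.
have c1 : 0 < 1 + c by lra.
have m0 : 0 < (1 + N%:R * (1 + c))^-1 by rewrite invr_gt0 addr_gt0 // mulr_gt0.
have a0 i : 0 < a i by case/andP: (ma i) => h _; apply: lt_le_trans h.
have a1 i : a i < 1 by case/andP: (ma i).
have x0 i : 0 <= x i by apply: le_trans (yx i).
have ca i : 0 < 1 + c * a i by rewrite ltr_wpDr // mulr_ge0 // ltW.
have p0 i : 0 < p i by rewrite divr_gt0 // subr_gt0.
have p1 i : p i < 1.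
  rewrite ltr_pdivrMr // mul1r.
  have := a0 i; have := mulr_ge0 c0 (ltW (a0 i)); lra.
have q0 i : 0 < 1 - p i by rewrite subr_gt0.
have P0 : 0 < P by apply: prodr_gt0.
pose X := \prod_i x i.
have fx i : 0 <= p i * x i + (1 - p i) * y i <= x i.
  apply/andP; split; first by apply: addr_ge0; apply: mulr_ge0; rewrite ?x0 ?y0 ?(ltW (q0 i)) ?(ltW (p0 i)).
  have := ler_wpM2l (ltW (q0 i)) (yx i); lra.
have ZX : Z <= X by apply: ler_prod => i _; apply: fx.
have [XP|PX] := leP X P.
  split=> [|cp ZP]; first exact: le_trans ZX XP.
  have XP' : X = P by apply/eqP; rewrite eq_le XP -ZP.
  have Z0 : 0 < Z by rewrite ZP.
  have h := prod_eq_pointwise fx Z0 (etrans ZP (esym XP')).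
  left=> i; have := h i => e.
  apply: (mulfI (lt0r_neq0 (q0 i))); lra.
have X0 : 0 < X by apply: lt_trans PX.
have xp i : 0 < x i.
  rewrite lt0r x0 andbT; apply/eqP => xi.
  by move: X0; rewrite /X (bigD1 i) //= xi mul0r ltxx.
pose t := P / X.
have t0 : 0 < t by rewrite divr_gt0.
have t1 : t < 1 by rewrite ltr_pdivrMr // mul1r.
have Xt : X * t = P by rewrite /t mulrC divfK // gt_eqF.
have yt i : y i <= t * x i.
  rewrite /t mulrAC ler_pdivlMr // {1}/X (bigD1 i) //= mulrCA mulrC.
  by rewrite ler_pM2r.
have [tr|tr] := ltP ((1 + c) ^- 2) t.
  suff ZP : Z < P by split=> [|_ e]; [apply: ltW | rewrite e ltxx in ZP].
  have hg : (1 + c) * \prod_i (1 + a i * ((1 + c) * t - 1)) <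
      (1 + c) * t * \prod_i (1 + a i * (1 + c - 1)).
    apply: balance_lt => //.
    - by rewrite cI.
    - by move=> i; rewrite a0 a1.
    - by move: tr; rewrite -exprVn expr2 ltr_pdivrMl.
    - by rewrite gtr_pMr.
  rewrite -mulrA ltr_pM2l // in hg.
  have hpt : \prod_i (p i + (1 - p i) * t) < t.
    have -> : \prod_i (p i + (1 - p i) * t) =
        \prod_i (1 + a i * ((1 + c) * t - 1)) / \prod_i (1 + a i * (1 + c - 1)).
      rewrite -prodf_div; apply: eq_bigr => i _; rewrite /p /kappa.
      have -> : 1 + a i * (1 + c - 1) = 1 + c * a i by ring.
      by field; exact: lt0r_neq0.
    rewrite ltr_pdivrMr //; apply: prodr_gt0 => i _.
    by have -> : 1 + a i * (1 + c - 1) = 1 + c * a i by ring.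
  apply: (@le_lt_trans _ _ (X * \prod_i (p i + (1 - p i) * t))); last first.
    by rewrite -Xt ltr_pM2l.
  rewrite -big_split /=; apply: ler_prod => i _; case/andP: (fx i) => -> _ /=.
  have := ler_wpM2l (ltW (q0 i)) (yt i); lra.
pose s i := kappa c (x i).
have s0 i : 0 <= s i by apply: kappa_ge0.
have s1 i : s i < 1.
  have cx : 0 < 1 + c * x i by rewrite ltr_wpDr // mulr_ge0.
  rewrite ltr_pdivrMr // mul1r; have := xp i; have := mulr_ge0 c0 (x0 i); lra.
have xs i : x i = (1 - s i) / (1 + c * s i) by rewrite -[LHS](kappaK c0 (x0 i) (x1 i)).
pose S := \sum_i s i.
have Si i : S - s i = \sum_(j | j != i) s j by rewrite /S (bigD1 i) //= [s i + _]addrC addrK.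
have hyx i : (1 + c) ^+ 2 * y i <= (1 - s i) / (1 + c * s i).
  rewrite -xs; apply: (@le_trans _ _ ((1 + c) ^+ 2 * (t * x i))).
    by rewrite ler_pM2l ?exprn_gt0.
  rewrite mulrA ler_piMl // mulrC -ler_pdivlMr ?exprn_gt0 // mul1r; exact: tr.
have hyT i : y i * (1 + c - c * (S - s i)) <= S - s i.
  have cy : 0 < 1 + c * y i by rewrite ltr_wpDr // mulr_ge0.
  have := hT i; rewrite -Si -lerBlDr ler_pdivlMr //; lra.
have s01 i : 0 <= s i < 1 by rewrite s0 s1.
have [h1 h2] := corner_bound cI N0 c0 sa ma s01 y0 hyx hyT.
have ZE : Z = P * \prod_i ((1 - s i) / (1 + c * s i) + (1 + c) * (a i / (1 - a i)) * y i).
  rewrite /P -big_split /=; apply: eq_bigr => i _; rewrite -xs /p /kappa.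
  have na : 1 - a i != 0 by rewrite subr_eq0 gt_eqF.
  by field; rewrite na lt0r_neq0.
rewrite ZE; split=> [|cp e]; first by rewrite ger_pMr.
have S0 : S = 0.
  apply/eqP; rewrite eq_le [0 <= S]sumr_ge0 // andbT leNgt; apply/negP => Sp.
  by have := h2 cp Sp; rewrite -(ltr_pM2l P0) mulr1 e ltxx.
right=> i; have si : s i = 0.
  by apply/eqP; have := S0; move/psumr_eq0P => ->.
have xi : x i = 1 by rewrite xs si mulr0 subr0 addr0 divr1.
split=> //; have := hyT i; rewrite S0 si subrr mulr0 subr0 pmulr_lle0 // => h.
by apply/eqP; rewrite eq_le h y0.
Qed.

(* Probability that [B] joined with a p-random subset of [s] lies in [F]. *)
Fixpoint cmu (R : nzRingType) (T : finType) (p : R) (F : {set {set T}}) (s : seq T)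
    (B : {set T}) : R :=
  if s is x :: s' then p * cmu p F s' (x |: B) + (1 - p) * cmu p F s' B
  else (B \in F)%:R.

Lemma cmu_ge0 (R : realFieldType) (T : finType) (p : R) (F : {set {set T}}) (s : seq T)
    (B : {set T}) :
  0 <= p -> p <= 1 -> 0 <= cmu p F s B.
Proof.
move=> p0 p1; elim: s B => [|x s IH] B /=; first exact: ler0n.
by rewrite addr_ge0 // mulr_ge0 // subr_ge0.
Qed.

Lemma cmu_le1 (R : realFieldType) (T : finType) (p : R) (F : {set {set T}}) (s : seq T)
    (B : {set T}) :
  0 <= p -> p <= 1 -> cmu p F s B <= 1.
Proof.
move=> p0 p1; elim: s B => [|x s IH] B /=; first by rewrite lern1 leq_b1.
have q0 : 0 <= 1 - p by rewrite subr_ge0.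
have := ler_wpM2l p0 (IH (x |: B)); have := ler_wpM2l q0 (IH B); lra.
Qed.

Lemma cmu_subset (R : realFieldType) (n : nat) (p : R) (F : {set {set 'I_n}}) s
    (B C : {set 'I_n}) :
  0 <= p -> p <= 1 -> increasing_family F -> B \subset C -> cmu p F s B <= cmu p F s C.
Proof.
move=> p0 p1 iF; elim: s B C => [|x s IH] B C BC /=.
  by case: (boolP (B \in F)) => BF; rewrite ?(iF _ _ BF BC).
by rewrite lerD // ler_wpM2l ?subr_ge0 // IH // setUS.
Qed.

Lemma cmu_shift (R : realFieldType) (T : finType) (p : R) (F : {set {set T}}) x (s : seq T)
    (B : {set T}) :
  cmu p [set A | x |: A \in F] s B = cmu p F s (x |: B).
Proof.
elim: s B => [|z s IH] B /=; first by rewrite inE.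
by rewrite !IH setUCA.
Qed.

Lemma cmu_sum (R : realFieldType) (T : finType) (p : R) (F : {set {set T}}) (s : seq T)
    (B : {set T}) :
  uniq s -> (forall z, z \in s -> z \notin B) ->
  cmu p F s B = \sum_(A in F | A :\: [set z in s] == B)
    \prod_(z <- s) (if z \in A then p else 1 - p).
Proof.
elim: s B => [|x s IH] B /=.
  move=> _ _; under eq_bigr do rewrite big_nil.
  rewrite (eq_bigl (fun A => (A == B) && (B \in F))); last first.
    move=> A; have -> : [set z in [::]] = set0 :> {set T} by apply/setP => z; rewrite !inE.
    by rewrite setD0 andbC; case: eqP => // ->.
  case: (B \in F); last by rewrite big_pred0 // => A; rewrite andbF.
  by rewrite (eq_bigl (pred1 B)) ?big_pred1_eq // => A; rewrite andbT.
case/andP=> xs us sB.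
have xB : x \notin B by apply: sB; rewrite inE eqxx.
have sB' z : z \in s -> z \notin B by move=> zs; apply: sB; rewrite inE zs orbT.
have sxB z : z \in s -> z \notin x |: B.
  move=> zs; rewrite !inE negb_or sB' // andbT.
  by apply: contraNneq xs => <-.
rewrite (bigID (fun A : {set T} => x \in A)) /= !IH // !mulr_sumr; congr (_ + _).
  rewrite [RHS](eq_bigr (fun A : {set T} => p * \prod_(z <- s) (if z \in A then p else 1 - p))).
    apply: eq_bigl => A; rewrite -andbA; congr andb.
    apply/eqP/andP => [e|[/eqP e xA]].
      have xA : x \in A by have := setU11 x B; rewrite -e inE => /andP[].
      split=> //; apply/eqP/setP => z; have := congr1 (fun D : {set T} => z \in D) e.
      rewrite !inE negb_or; have [->|zx] //= := eqVneq z x.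
      by rewrite (negbTE xB).
    apply/setP => z; have := congr1 (fun D : {set T} => z \in D) e.
    by rewrite !inE negb_or; have [->|zx] //= := eqVneq z x; rewrite xs xA.
  by move=> A /andP[_ xA]; rewrite big_cons xA.
rewrite [RHS](eq_bigr (fun A : {set T} => (1 - p) * \prod_(z <- s) (if z \in A then p else 1 - p))).
  apply: eq_bigl => A; rewrite -andbA; congr andb.
  apply/eqP/andP => [e|[/eqP e xA]].
    have xA : x \notin A.
      by apply: contra xB => xA; rewrite -e !inE xA xs.
    split=> //; apply/eqP/setP => z; have := congr1 (fun D : {set T} => z \in D) e.
    by rewrite !inE negb_or; have [->|zx] //= := eqVneq z x; rewrite (negbTE xB).
  apply/setP => z; have := congr1 (fun D : {set T} => z \in D) e.
  rewrite !inE negb_or; have [->|zx] //= := eqVneq z x.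
  by rewrite (negbTE xA) andbF (negbTE xB).
by move=> A /andP[_ xA]; rewrite big_cons (negbTE xA).
Qed.

Lemma mu_cmu (R : realType) (n : nat) (p : R) (F : {set {set 'I_n}}) s :
  uniq s -> (forall x, x \in s) -> mu p F = cmu p F s set0.
Proof.
move=> us sT; rewrite cmu_sum //; last by move=> z _; rewrite inE.
apply: eq_big => A; last first.
  move=> _; rewrite (perm_big (enum 'I_n)) /=; last first.
    by apply: uniq_perm => //; rewrite ?enum_uniq // => x; rewrite sT mem_enum.
  rewrite big_enum /= (bigID (fun z => z \in A)) /=; congr (_ * _).
    by rewrite (eq_bigr (fun=> p)) ?prodr_const // => z ->.
  rewrite (eq_bigr (fun=> 1 - p)) => [|z /negbTE -> //].
  rewrite prodr_const; congr (_ ^+ _).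
  have -> : #|(fun z => z \notin A)| = #|~: A| by apply: eq_card => z; rewrite !inE.
  by rewrite -(addKn #|A| #|~: A|) cardsC card_ord.
suff -> : A :\: [set z in s] = set0 by rewrite eqxx andbT.
by apply/setP => z; rewrite !inE sT.
Qed.

Lemma mu_ge0 (R : realType) (n : nat) (p : R) (F : {set {set 'I_n}}) :
  0 <= p -> p <= 1 -> 0 <= mu p F.
Proof.
move=> p0 p1; apply: sumr_ge0 => A _.
by rewrite mulr_ge0 // exprn_ge0 // subr_ge0.
Qed.

Lemma mu_subset (R : realType) (n : nat) (p : R) (F G : {set {set 'I_n}}) :
  0 < p -> p < 1 -> F \subset G -> mu p F <= mu p G /\ (mu p F = mu p G -> F = G).
Proof.
move=> p0 p1 FG.
have w0 (A : {set 'I_n}) : 0 < p ^+ #|A| * (1 - p) ^+ (n - #|A|).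
  by rewrite mulr_gt0 // exprn_gt0 // subr_gt0.
have e : mu p G = mu p F + mu p (G :\: F).
  rewrite /mu (big_setID F) /=; congr (_ + _).
  by rewrite (setIidPr FG).
have GF0 : 0 <= mu p (G :\: F) by apply: mu_ge0; exact: ltW.
split; first by rewrite e lerDl.
move/eqP; rewrite e -subr_eq0 opprD addrA subrr add0r oppr_eq0.
rewrite psumr_eq0 => [/allP h|A _]; last exact: ltW.
apply/eqP; rewrite eqEsubset FG; apply/subsetP => A AG.
apply/negPn/negP => AF; have := h A (mem_index_enum A).
by rewrite inE AF AG /= gt_eqF.
Qed.

Lemma enum_rem (n : nat) (x : 'I_n) (s := rem x (enum 'I_n)) :
  uniq (x :: s) /\ forall z, z \in x :: s.
Proof.
have xs : x \notin s by rewrite mem_rem_uniq ?enum_uniq // inE eqxx.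
split; first by rewrite /= xs rem_uniq ?enum_uniq.
by move=> z; rewrite inE mem_rem_uniq ?enum_uniq // inE mem_enum andbT; case: eqP.
Qed.

Lemma mu_full_star (R : realType) (n : nat) (p : R) (x : 'I_n) : mu p (full_star x) = p.
Proof.
have [us sT] := enum_rem x; have /andP[xe _] := us; rewrite (mu_cmu _ _ us) //=.
have s1 s (B : {set 'I_n}) : x \in B -> cmu p (full_star x) s B = 1.
  elim: s B => [|z s IH] B xB /=; first by rewrite inE xB.
  by rewrite !IH ?inE ?xB ?orbT //; ring.
have s0 s (B : {set 'I_n}) : x \notin s -> x \notin B -> cmu p (full_star x) s B = 0.
  elim: s B => [|z s IH] B /=; first by rewrite inE => _ /negbTE ->.
  rewrite inE negb_or => /andP[xz xs] xB.
  by rewrite !IH // ?inE ?negb_or ?xz //; ring.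
by rewrite s1 ?setU11 // s0 ?inE //; ring.
Qed.

Lemma cross_escape (n r : nat) (F : 'I_r -> {set {set 'I_n}}) (B : 'I_r -> {set 'I_n}) :
  cross_intersecting F -> (forall z, exists i, z \notin B i) -> exists i, B i \notin F i.
Proof.
move=> cF hB; have [i Bi|h] := pickP (fun i => B i \notin F i); first by exists i.
have /set0Pn[z /bigcapP hz] := cF B (fun i => negbFE (h i)).
by have [i] := hB z; rewrite hz.
Qed.

Lemma mixed_disjoint (T : finType) (r : nat) (B : 'I_r -> {set T}) x (s : seq T) i
    (C := fun j => if j == i then B i else x |: B j) :
  x \notin s -> (forall j z, z \in x :: s -> z \notin B j) ->
  (forall z, exists j, z \notin B j) ->
  (forall j z, z \in s -> z \notin C j) /\ (forall z, exists j, z \notin C j).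
Proof.
move=> xs sB hB; split=> [j z zs|z].
  rewrite /C; case: ifP => _; first by rewrite sB // inE zs orbT.
  rewrite !inE negb_or sB ?inE ?zs ?orbT // andbT.
  by apply: contraNneq xs => <-.
have [->|zx] := eqVneq z x; first by exists i; rewrite /C eqxx sB // inE eqxx.
by have [j zj] := hB z; exists j; rewrite /C; case: eqP => [<-//|_]; rewrite !inE negb_or zx.
Qed.

(* Only the tuples with exactly one coordinate [x |: B i] replaced by [B i] are needed. *)
Lemma mixed_bounds (R : realType) (n N : nat) (p : 'I_N.+1 -> R) (P c : R)
    (F : 'I_N.+1 -> {set {set 'I_n}}) (x : 'I_n) (s : seq 'I_n)
    (B : 'I_N.+1 -> {set 'I_n})
    (X := fun i => cmu (p i) (F i) s (x |: B i)) (Y := fun i => cmu (p i) (F i) s (B i)) :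
  (forall C : 'I_N.+1 -> {set 'I_n},
    (forall i z, z \in s -> z \notin C i) -> (forall z, exists i, z \notin C i) ->
    \prod_i cmu (p i) (F i) s (C i) <= P /\
    1 <= \sum_i kappa c (cmu (p i) (F i) s (C i))) ->
  x \notin s -> (forall i z, z \in x :: s -> z \notin B i) ->
  (forall z, exists i, z \notin B i) ->
  forall i, Y i * \prod_(j | j != i) X j <= P /\
    1 <= kappa c (Y i) + \sum_(j | j != i) kappa c (X j).
Proof.
move=> IH xs sB hB i.
have [sC hC] := mixed_disjoint i xs sB hB.
have [h1 h2] := IH _ sC hC; split.
  apply: le_trans h1; rewrite [leRHS](bigD1 i) //= eqxx.
  by rewrite [in leRHS](eq_bigr X) // => j /negbTE ->.
apply: le_trans h2 _; rewrite (bigD1 i) //= eqxx.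
by rewrite (eq_bigr (fun j => kappa c (X j))) // => j /negbTE ->.
Qed.

Lemma cmu_bounds (R : realType) (n N : nat) (c : R) (a : 'I_N.+1 -> R)
    (F : 'I_N.+1 -> {set {set 'I_n}}) (p := fun i => kappa c (a i)) :
  (0 < N)%N -> 0 <= c -> \sum_i a i = 1 ->
  (forall i, (1 + N%:R * (1 + c))^-1 <= a i < 1) ->
  cross_intersecting F -> (forall i, increasing_family (F i)) ->
  forall (s : seq 'I_n) (B : 'I_N.+1 -> {set 'I_n}), uniq s ->
  (forall i z, z \in s -> z \notin B i) -> (forall z, exists i, z \notin B i) ->
  \prod_i cmu (p i) (F i) s (B i) <= \prod_i p i /\
  1 <= \sum_i kappa c (cmu (p i) (F i) s (B i)).
Proof.
move=> N0 c0 sa ma cF iF.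
have a0 i : 0 <= a i.
  case/andP: (ma i) => h _; apply: le_trans h.
  by rewrite invr_ge0 addr_ge0 // mulr_ge0 // addr_ge0.
have a1 i : a i <= 1 by case/andP: (ma i) => _ /ltW.
have p0 i : 0 <= p i by apply: kappa_ge0.
have p1 i : p i <= 1.
  rewrite ler_pdivrMr ?mul1r ?ltr_wpDr ?mulr_ge0 //.
  have := mulr_ge0 c0 (a0 i); have := a0 i; lra.
have M0 i s B : 0 <= cmu (p i) (F i) s B by apply: cmu_ge0.
have M1 i s B : cmu (p i) (F i) s B <= 1 by apply: cmu_le1.
elim=> [|x s IH] B /=.
  move=> _ _ hB; have [i Bi] := cross_escape cF hB; split.
    by rewrite (bigD1 i) //= (negbTE Bi) mul0r prodr_ge0.
  rewrite (bigD1 i) //= (negbTE Bi) {1}/kappa mulr0 subr0 addr0 divr1 lerDl.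
  by apply: sumr_ge0 => j _; apply: kappa_ge0; rewrite ?ler0n ?lern1 ?leq_b1.
case/andP=> xs us sB hB.
pose X i := cmu (p i) (F i) s (x |: B i); pose Y i := cmu (p i) (F i) s (B i).
have YX i : Y i <= X i by apply: cmu_subset => //; apply: subsetUr.
have sub := mixed_bounds (fun C => IH C us) xs sB hB.
split.
  by have [] := product_step (card_ord _) N0 c0 sa ma (fun i => M0 i s (B i)) YX
    (fun i => M1 i s (x |: B i)) (fun i => (sub i).1) (fun i => (sub i).2).
apply: (@le_trans _ _ (\sum_i ((1 - a i) * kappa c (X i) + a i * kappa c (Y i)))); last first.
  by apply: ler_sum => i _; apply: kappa_step; rewrite // ?M0 ?M1.
pose KX := \sum_i kappa c (X i).
have -> : \sum_i ((1 - a i) * kappa c (X i) + a i * kappa c (Y i)) =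
    \sum_i a i * (kappa c (Y i) + (KX - kappa c (X i))).
  rewrite (eq_bigr (fun i => (kappa c (X i) - a i * kappa c (X i)) + a i * kappa c (Y i))).
    rewrite [RHS](eq_bigr (fun i => (a i * KX - a i * kappa c (X i)) + a i * kappa c (Y i))).
      by rewrite !big_split /= -mulr_suml sa mul1r.
    by move=> i _; ring.
  by move=> i _; ring.
rewrite -{1}sa; apply: ler_sum => i _; rewrite ler_peMr //.
have [_] := sub i; rewrite /KX [in X in _ -> X](bigD1 i) //=.
by rewrite [kappa c (X i) + _]addrC addrK.
Qed.

Lemma mu_setT (R : realType) (n : nat) (p : R) : mu p [set: {set 'I_n}] = 1.
Proof.
rewrite (@mu_cmu _ _ _ _ (enum 'I_n)) ?enum_uniq // => [|x]; last by rewrite mem_enum.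
elim: (enum _) (set0) => [|x s IH] B /=; first by rewrite inE.
by rewrite !IH; ring.
Qed.

Lemma mu_shift (R : realType) (n : nat) (p : R) (F : {set {set 'I_n}}) (x : 'I_n) :
  mu p [set A | x |: A \in F] = cmu p F (rem x (enum 'I_n)) [set x].
Proof.
have [us sT] := enum_rem x; rewrite (mu_cmu _ _ us) //= !cmu_shift !setU0 setUid.
by ring.
Qed.

Lemma cmu_star (R : realType) (n : nat) (p : R) (F : {set {set 'I_n}}) (x : 'I_n) :
  0 < p -> p < 1 -> cmu p F (rem x (enum 'I_n)) [set x] = 1 ->
  cmu p F (rem x (enum 'I_n)) set0 = 0 -> F = full_star x.
Proof.
move=> p0 p1 X1 Y0; have [us sT] := enum_rem x.
have [_ hT] := mu_subset p0 p1 (subsetT [set A | x |: A \in F]).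
have {}hT := hT (etrans (mu_shift p F x) (etrans X1 (esym (mu_setT n p)))).
have sF : full_star x \subset F.
  apply/subsetP => A; rewrite inE => xA.
  have : A \in [set A | x |: A \in F] by rewrite hT inE.
  by rewrite inE (setUidPr _) // sub1set.
have [_ h] := mu_subset p0 p1 sF; apply/esym/h.
by rewrite mu_full_star (mu_cmu _ _ us) //= setU0 X1 Y0; ring.
Qed.

Lemma cmu_indep (R : realType) (n : nat) (p : R) (F : {set {set 'I_n}}) (x : 'I_n) :
  0 < p -> p < 1 -> increasing_family F ->
  cmu p F (rem x (enum 'I_n)) [set x] = cmu p F (rem x (enum 'I_n)) set0 ->
  forall A, A \in F -> A :\ x \in F.
Proof.
move=> p0 p1 iF XY A AF; have [us sT] := enum_rem x.
have FF : F \subset [set A | x |: A \in F].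
  by apply/subsetP => C CF; rewrite inE (iF _ _ CF) // subsetUr.
have [_ h] := mu_subset p0 p1 FF.
rewrite h; last by rewrite mu_shift (mu_cmu _ _ us) //= setU0 XY; ring.
rewrite inE; have [xA|xA] := boolP (x \in A); first by rewrite setD1K.
by apply: (iF _ _ AF); apply/subsetP => z zA; rewrite !inE zA andbT orbN.
Qed.

Lemma strict_equality (R : realType) (n N : nat) (c : R) (a : 'I_N.+1 -> R)
    (F : 'I_N.+1 -> {set {set 'I_n}}) (p := fun i => kappa c (a i)) :
  (0 < N)%N -> 0 < c -> \sum_i a i = 1 ->
  (forall i, (1 + N%:R * (1 + c))^-1 <= a i < 1) ->
  cross_intersecting F -> (forall i, increasing_family (F i)) ->
  \prod_i mu (p i) (F i) = \prod_i p i -> exists x, forall i, F i = full_star x.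
Proof.
move=> N0 cp sa ma cF iF E.
have c0 := ltW cp.
have a0 i : 0 < a i.
  case/andP: (ma i) => h _; apply: lt_le_trans h.
  by rewrite invr_gt0 addr_gt0 // mulr_gt0 ?ltr0n // addr_gt0.
have a1 i : a i < 1 by case/andP: (ma i).
have p0 i : 0 < p i by rewrite divr_gt0 ?subr_gt0 // addr_gt0 // mulr_gt0.
have p1 i : p i < 1.
  rewrite ltr_pdivrMr ?mul1r ?addr_gt0 ?mulr_gt0 //.
  have := mulr_gt0 cp (a0 i); have := a0 i; lra.
have P0 : 0 < \prod_i p i by apply: prodr_gt0.
pose X x i := cmu (p i) (F i) (rem x (enum 'I_n)) [set x].
pose Y x i := cmu (p i) (F i) (rem x (enum 'I_n)) set0.
have step x : (forall i, X x i = Y x i) \/ (forall i, X x i = 1 /\ Y x i = 0).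
  have [us sT] := enum_rem x; have /andP[xs us'] := us.
  pose B (i : 'I_N.+1) : {set 'I_n} := set0.
  have sB i z : z \in x :: rem x (enum 'I_n) -> z \notin B i by rewrite /B in_set0.
  have hB z : exists i, z \notin B i by exists ord0; rewrite /B inE.
  have sub := mixed_bounds (fun C => cmu_bounds N0 c0 sa ma cF iF us') xs sB hB.
  have [_ h] := product_step (card_ord _) N0 c0 sa ma
    (fun i => cmu_ge0 _ _ _ (ltW (p0 i)) (ltW (p1 i)))
    (fun i => cmu_subset _ (ltW (p0 i)) (ltW (p1 i)) (iF i) (subsetUr _ _))
    (fun i => cmu_le1 _ _ _ (ltW (p0 i)) (ltW (p1 i)))
    (fun i => (sub i).1) (fun i => (sub i).2).
  have {}h := h cp; rewrite /X /Y -(setU0 [set x]); apply: h.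
  by rewrite -E; apply: eq_bigr => i _; rewrite (mu_cmu _ _ us).
have [x /forallP hx|hx] := pickP (fun x => [forall i, (X x i == 1) && (Y x i == 0)]).
  by exists x => i; have /andP[/eqP h1 /eqP h2] := hx i; apply: (cmu_star (p := p i)).
have XY x i : X x i = Y x i.
  have [//|h] := step x; have /negP[] := negbT (hx x).
  by apply/forallP => j; have [-> ->] := h j; rewrite !eqxx.
suff F0 i : set0 \in F i.
  have /set0Pn[z] := cF (fun=> set0) F0; move/bigcapP/(_ ord0 isT).
  by rewrite inE.
have [A AF] : exists A, A \in F i.
  apply/set0Pn; apply/eqP => Fi; move: P0; rewrite -E (bigD1 i) //= Fi.
  by rewrite /mu big_set0 mul0r ltxx.
case: (arg_minnP (fun A : {set 'I_n} => #|A|) AF) => C CF minC.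
suff -> : set0 = C by [].
apply/esym/eqP; rewrite -subset0; apply/subsetP => z zC.
have := minC _ (cmu_indep (p0 i) (p1 i) (iF i) (XY z i) CF).
by rewrite (cardsD1 z C) zC ltnn.
Qed.

(* Take [C] of least size with [~: C \notin F ord0]; splitting [C] among three
   parts contradicts uniqueness unless [C] is a singleton, the centre. *)
Lemma exact_cover_star (n N : nat) (F : 'I_N.+1 -> {set {set 'I_n}}) :
  (1 < N)%N -> (forall i, increasing_family (F i)) -> (forall i, setT \in F i) ->
  (forall f : 'I_n -> 'I_N.+1, exists i, [set z | f z != i] \notin F i) ->
  (forall (f : 'I_n -> 'I_N.+1) i j, [set z | f z != i] \notin F i ->
    [set z | f z != j] \notin F j -> i = j) ->
  exists z, F ord0 \subset full_star z /\
    forall j, j != ord0 -> full_star z \subset F j.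
Proof.
move=> N1 iF FT H1 H2.
pose i0 : 'I_N.+1 := ord0.
pose i1 : 'I_N.+1 := Ordinal (leq_trans N1 (leqnSn N) : (1 < N.+1)%N).
pose i2 : 'I_N.+1 := Ordinal (N1 : (2 < N.+1)%N).
have pre (f : 'I_n -> 'I_N.+1) i (D : {set 'I_n}) : (forall z, (f z == i) = (z \in D)) ->
    [set z | f z != i] = ~: D.
  by move=> h; apply/setP => z; rewrite !inE h.
have triv (f : 'I_n -> 'I_N.+1) i : (forall z, f z != i) -> [set z | f z != i] \in F i.
  by move=> h; rewrite (pre _ _ set0) ?setC0 // => z; rewrite inE (negbTE (h z)).
have UT : ~: [set: 'I_n] \notin F i0.
  have [i Hi] := H1 (fun=> i0); have [e|/eqP ii0] := i =P i0.
    by move: Hi; rewrite e (pre (fun=> i0) i0 setT) // => z; rewrite in_setT eqxx.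
  by move: Hi; rewrite (triv (fun=> i0)) // => z; rewrite eq_sym.
case: (@arg_minnP _ [set: 'I_n] (fun C : {set 'I_n} => ~: C \notin F i0) (fun C => #|C|) UT) => C UC minC.
have small (D : {set 'I_n}) : (#|D| < #|C|)%N -> ~: D \in F i0.
  by move=> DC; apply/negPn/negP => /minC; rewrite leqNgt DC.
have [z zC] : exists z, z \in C.
  by apply/set0Pn; apply: contra UC => /eqP ->; rewrite setC0.
have compl i : i != i0 -> C \in F i.
  move=> ii0; apply/negPn/negP => Ui.
  pose f y := if y \in C then i0 else i.
  suff e : i0 = i by rewrite e eqxx in ii0.
  apply: (H2 f).
    by rewrite (pre _ _ C) // => y; rewrite /f; case: (y \in C); rewrite ?eqxx // (negbTE ii0).
  rewrite (pre _ _ (~: C)) ?setCK // => y; rewrite !inE /f.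
  by case: (y \in C); rewrite ?eqxx // eq_sym (negbTE ii0).
have Cz : C :\ z = set0.
  apply/eqP; apply/negPn/negP => /set0Pn[w wC].
  have cz : ~: [set z] \in F i0.
    by apply: small; rewrite cards1 (cardsD1 z) zC ltnS card_gt0; apply/set0Pn; exists w.
  have cD : ~: (C :\ z) \in F i0 by apply: small; rewrite (cardsD1 z C) zC.
  pose f (j1 j2 j3 : 'I_N.+1) y := if y == z then j1 else if y \in C then j2 else j3.
  have fE j1 j2 j3 : j1 != j2 -> j1 != j3 -> j2 != j3 ->
    [/\ [set y | f j1 j2 j3 y != j1] = ~: [set z],
        [set y | f j1 j2 j3 y != j2] = ~: (C :\ z),
        [set y | f j1 j2 j3 y != j3] = C &
        forall i, i \notin [:: j1; j2; j3] -> [set y | f j1 j2 j3 y != i] \in F i].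
    move=> d12 d13 d23; split; last first.
    - move=> i; rewrite !inE !negb_or => /and3P[n1 n2 n3]; apply: triv => y.
      by rewrite /f; case: ifP => _; [|case: ifP => _]; rewrite eq_sym.
    - rewrite (pre _ _ (~: C)) ?setCK // => y; rewrite inE /f; have [->|yz] := eqVneq y z.
        by rewrite zC (negbTE d13).
      by case: (y \in C); rewrite ?eqxx // (negbTE d23).
    - apply: pre => y; rewrite !inE /f; have [->|yz] /= := eqVneq y z; first exact: negbTE.
      by case: (y \in C); rewrite ?eqxx // eq_sym (negbTE d23).
    apply: pre => y; rewrite !inE /f; have [_|yz] /= := eqVneq y z; first by rewrite eqxx.
    by case: (y \in C); rewrite eq_sym ?(negbTE d12) ?(negbTE d13).
  have U1 : ~: (C :\ z) \notin F i1.
    have [e1 e2 e3 e4] := fE i0 i1 i2 isT isT isT; have [i] := H1 (f i0 i1 i2).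
    have [/e4 -> //|] := boolP (i \notin [:: i0; i1; i2]).
    rewrite negbK !inE => /or3P[] /eqP ->; rewrite ?e1 ?e2 ?e3 ?cz //.
    by rewrite compl.
  have U2 : ~: [set z] \notin F i2.
    have [e1 e2 e3 e4] := fE i2 i0 i1 isT isT isT; have [i] := H1 (f i2 i0 i1).
    have [/e4 -> //|] := boolP (i \notin [:: i2; i0; i1]).
    rewrite negbK !inE => /or3P[] /eqP ->; rewrite ?e1 ?e2 ?e3 ?cD //.
    by rewrite compl.
  have [e1 e2 e3 _] := fE i2 i1 i0 isT isT isT.
  by have := H2 (f i2 i1 i0) i2 i1; rewrite e1 e2 => /(_ U2 U1).
have C1 : C = [set z] by rewrite -(setD1K zC) Cz setU0.
have F0 : F i0 \subset full_star z.
  apply/subsetP => A AF; rewrite inE; apply/negPn/negP => zA.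
  move: UC; rewrite C1 (iF _ _ _ AF) //; apply/subsetP => y yA; rewrite !inE.
  by apply: contraNneq zA => <-.
exists z; split=> // j j0; apply/subsetP => A; rewrite inE => zA.
apply/negPn/negP => Aj.
pose f y := if y \in A then i0 else j.
suff e : i0 = j by rewrite -e eqxx in j0.
apply: (H2 f).
  rewrite (pre _ _ A) => [|y]; last first.
    by rewrite /f; case: (y \in A); rewrite ?eqxx // (negbTE j0).
  by apply/negP => /(subsetP F0); rewrite !inE zA.
rewrite (pre _ _ (~: A)) ?setCK // => y; rewrite !inE /f.
by case: (y \in A); rewrite ?eqxx // eq_sym (negbTE j0).
Qed.

(* The defect of a set of free coordinates is the mean of the defects obtained
   by leaving the next coordinate out of exactly one of the [B i]; these are
   all at least 1, so a defect equal to 1 propagates to every leaf. *)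
Lemma tight_leaves (R : realType) (n N : nat) (F : 'I_N.+1 -> {set {set 'I_n}})
    (p := 1 - N.+1%:R^-1 : R) :
  (forall (s : seq 'I_n) (B : 'I_N.+1 -> {set 'I_n}), uniq s ->
    (forall i z, z \in s -> z \notin B i) -> (forall z, exists i, z \notin B i) ->
    1 <= \sum_i (1 - cmu p (F i) s (B i))) ->
  forall (s : seq 'I_n) (B : 'I_N.+1 -> {set 'I_n}), uniq s ->
  (forall i z, z \in s -> z \notin B i) -> (forall z, exists i, z \notin B i) ->
  \sum_i (1 - cmu p (F i) s (B i)) = 1 ->
  forall f : 'I_n -> 'I_N.+1,
    \sum_i (1 - (B i :|: [set z in s | f z != i] \in F i)%:R) = 1 :> R.
Proof.
move=> lb; elim=> [|x s IH] B.
  move=> _ _ _ /= E f; rewrite -[RHS]E; apply: eq_bigr => i _.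
  have -> : B i :|: [set z in [::] | f z != i] = B i by apply/setP => z; rewrite !inE orbF.
  by [].
move=> /= /andP[xs us] sB hB E f.
have N0 : 0 < (N.+1%:R : R) by rewrite ltr0n.
pose C j i := if i == j then B j else x |: B i.
pose D j := \sum_i (1 - cmu p (F i) s (C j i)).
have sC j := mixed_disjoint j xs sB hB.
have D1 j : 1 <= D j by have [h1 h2] := sC j; exact: (lb s (C j) us h1 h2).
pose X i := cmu p (F i) s (x |: B i); pose Y i := cmu p (F i) s (B i).
have DE j : D j = \sum_i (1 - X i) + (X j - Y j).
  rewrite /D (bigD1 j) //= [in RHS](bigD1 j) //= /C eqxx.
  rewrite (eq_bigr (fun i => 1 - X i)) => [|i /negbTE -> //].
  by rewrite -/(Y j) -/(X j); ring.
have two_point (u v w : R) : 1 - ((1 - w) * u + (1 - (1 - w)) * v) = 1 - u + w * (u - v).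
  by ring.
have sD : \sum_j D j = N.+1%:R.
  rewrite (eq_bigr _ (fun j _ => DE j)) big_split /= sumr_const card_ord -[(\sum_i (1 - X i)) *+ _]mulr_natl.
  transitivity (N.+1%:R * \sum_i (1 - (p * X i + (1 - p) * Y i))); last by rewrite E mulr1.
  rewrite [in RHS](eq_bigr (fun i => (1 - X i) + N.+1%:R^-1 * (X i - Y i))) => [|i _]; last first.
    exact: two_point.
  by rewrite [in RHS]big_split /= -mulr_sumr mulrDr mulrA mulfV ?mul1r // gt_eqF.
have Dj j : D j = 1.
  apply/eqP; rewrite eq_le D1 andbT -(lerD2r (\sum_(i | i != j) 1)).
  have : \sum_(i < N.+1) 1 = N.+1%:R :> R by rewrite sumr_const card_ord.
  rewrite (bigD1 j) //= => ->; rewrite -sD [leRHS](bigD1 j) //= lerD2l.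
  by apply: ler_sum.
have [h1 h2] := sC (f x).
rewrite -[RHS](IH (C (f x)) us h1 h2 (Dj (f x)) f); apply: eq_bigr => i _.
suff -> : B i :|: [set z in x :: s | f z != i] = C (f x) i :|: [set z in s | f z != i] by [].
apply/setP => z; rewrite !inE /C [in RHS](fun_if (fun D : {set 'I_n} => z \in D)) !inE.
have [->|zx] /= := eqVneq z x; last by rewrite fun_if; case: (i =P f x) => [<-|].
by rewrite [f x == i]eq_sym; case: eqP => [<-|] /=; rewrite ?(negbTE xs) ?orbF ?orbT.
Qed.

Lemma uniform_equality (R : realType) (n N : nat) (F : 'I_N.+1 -> {set {set 'I_n}})
    (p := 1 - N.+1%:R^-1 : R) :
  (1 < N)%N -> cross_intersecting F -> (forall i, increasing_family (F i)) ->
  \prod_i mu p (F i) = \prod_(i < N.+1) p -> exists x, forall i, F i = full_star x.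
Proof.
move=> N1 cF iF E.
have N0 : (0 < N)%N by apply: ltnW.
have NR : 1 < N.+1%:R :> R by rewrite ltr1n.
have SN0 : N.+1%:R != 0 :> R by rewrite pnatr_eq0.
have u0 : 0 < N.+1%:R^-1 :> R by rewrite invr_gt0 ltr0n.
have u1 : N.+1%:R^-1 < 1 :> R by rewrite invf_lt1 // ltr0n.
have p0 : 0 < p by rewrite subr_gt0.
have p1 : p < 1 by rewrite ltrBlDr ltrDl.
have k0 s : kappa 0 s = 1 - s :> R by rewrite /kappa mul0r addr0 divr1.
have sa : \sum_(i < N.+1) N.+1%:R^-1 = 1 :> R by rewrite sumr_const card_ord -(mulr_natl _^-1) mulfV.
have ma (i : 'I_N.+1) : (1 + N%:R * (1 + 0))^-1 <= (N.+1%:R^-1 : R) < 1.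
  by rewrite addr0 mulr1 addrC natr1 lexx u1.
have lb (s : seq 'I_n) (B : 'I_N.+1 -> {set 'I_n}) : uniq s ->
    (forall i z, z \in s -> z \notin B i) -> (forall z, exists i, z \notin B i) ->
    1 <= \sum_i (1 - cmu p (F i) s (B i)).
  move=> us sB hB; have [_ h] := cmu_bounds N0 (lexx 0) sa ma cF iF us sB hB.
  by apply: le_trans h _; apply: ler_sum => i _; rewrite !k0.
have s0 (z : 'I_n) : exists i : 'I_N.+1, z \notin (fun=> set0) i by exists ord0; rewrite inE.
have s1 (i : 'I_N.+1) z : z \in enum 'I_n -> z \notin (fun=> set0 : {set 'I_n}) i by rewrite inE.
have muE i : mu p (F i) = cmu p (F i) (enum 'I_n) set0.
  by apply: mu_cmu; rewrite ?enum_uniq // => x; rewrite mem_enum.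
have m0 i : 0 <= mu p (F i) by apply: mu_ge0; apply: ltW.
have sm : \sum_i mu p (F i) <= N.+1%:R * p.
  have := lb _ _ (enum_uniq _) s1 s0.
  rewrite big_split /= sumr_const card_ord sumrN (eq_bigr _ (fun i _ => esym (muE i))).
  by rewrite /p mulrBr mulr1 mulfV // lerBrDr addrC -lerBrDr.
have [le1 eq1] := leif_AGM (A := predT) (fun i _ => m0 i).
have muC i j : mu p (F i) = mu p (F j).
  suff /forall_inP/(_ i isT)/forall_inP/(_ j isT)/eqP : 
    [forall i in predT, forall j in predT, mu p (F i) == mu p (F j)] by [].
  rewrite -eq1 eq_le le1 /= E prodr_const !card_ord.
  rewrite lerXn2r ?nnegrE ?divr_ge0 ?sumr_ge0 ?(ltW p0) //.
  by rewrite ler_pdivrMr ?ltr0n // mulrC.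
have mp i : mu p (F i) = p.
  apply/eqP; rewrite -(@eqrXn2 _ N.+1) ?(ltW p0) //; apply/eqP.
  move: E; rewrite prodr_const card_ord => <-.
  by rewrite (eq_bigr _ (fun j _ => muC j i)) prodr_const card_ord.
have tight : \sum_i (1 - cmu p (F i) (enum 'I_n) set0) = 1.
  rewrite -[RHS]sa; apply: eq_bigr => i _.
  by rewrite -muE mp /p opprB addrC subrK.
have leaves := tight_leaves lb (enum_uniq _) s1 s0 tight.
have simp (f : 'I_n -> 'I_N.+1) i : set0 :|: [set z in enum 'I_n | f z != i] = [set z | f z != i].
  by rewrite set0U; apply/setP => z; rewrite !inE mem_enum.
have FT i : setT \in F i.
  have /set0Pn[A AF] : F i != set0.
    by apply/eqP => Fi; move: p0; rewrite -(mp i) Fi /mu big_set0 ltxx.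
  by apply: (iF i _ _ AF); rewrite subsetT.
have H1 (f : 'I_n -> 'I_N.+1) : exists i, [set z | f z != i] \notin F i.
  have [i Hi|h] := pickP (fun i => [set z | f z != i] \notin F i); first by exists i.
  suff /esym/eqP : 0 = 1 :> R by rewrite oner_eq0.
  rewrite -[RHS](leaves f) big1 // => i _; rewrite simp.
  by have /negbFE -> := h i; rewrite subrr.
have H2 (f : 'I_n -> 'I_N.+1) i j : [set z | f z != i] \notin F i ->
    [set z | f z != j] \notin F j -> i = j.
  move=> Hi Hj; apply/eqP/negPn/negP => ij; have := leaves f.
  rewrite (bigD1 i) //= (bigD1 j) 1?eq_sym //= !simp (negbTE Hi) (negbTE Hj) !subr0.
  move/eqP; rewrite -subr_eq0 addrAC subrr add0r gt_eqF // ltr_pwDl ?ltr01 //.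
  by apply: sumr_ge0 => k _; rewrite subr_ge0 lern1 leq_b1.
have [z [F0 Fj]] := exact_cover_star N1 iF FT H1 H2.
exists z => i; have [->|i0] := eqVneq i ord0.
  by have [_] := mu_subset p0 p1 F0; apply; rewrite mp mu_full_star.
by have [_ h] := mu_subset p0 p1 (Fj i i0); apply/esym/h; rewrite mp mu_full_star.
Qed.

Lemma increasing_bound (R : realType) (n N : nat) (p : 'I_N.+1 -> R)
    (F : 'I_N.+1 -> {set {set 'I_n}}) :
  (0 < N)%N -> (forall i, 0 < p i <= 1 - N.+1%:R^-1) ->
  cross_intersecting F -> (forall i, increasing_family (F i)) ->
  \prod_i mu (p i) (F i) <= \prod_i p i /\
  (\prod_i mu (p i) (F i) = \prod_i p i ->
    (exists x, forall i, F i = full_star x) \/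
    N = 1%N /\ forall i, p i = 1 - N.+1%:R^-1).
Proof.
move=> N0 hp cF iF.
have SN0 : 0 < N.+1%:R :> R by rewrite ltr0n.
have p0 i : 0 < p i by case/andP: (hp i).
have pu i : p i <= 1 - N.+1%:R^-1 by case/andP: (hp i).
have p1 i : p i < 1 by apply: le_lt_trans (pu i) _; rewrite ltrBlDr ltrDl invr_gt0.
have q0 i : 0 < 1 - p i by rewrite subr_gt0.
pose o i := p i / (1 - p i).
have o0 i : 0 < o i by rewrite divr_gt0.
have oE i : (1 + o i)^-1 = 1 - p i.
  by rewrite /o; field; rewrite gt_eqF // lt0r_neq0 //; have := q0 i; lra.
have su : \sum_(i < N.+1) N.+1%:R^-1 = 1 :> R.
  by rewrite sumr_const card_ord -(mulr_natl _^-1) mulfV // gt_eqF.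
have so : 1 <= \sum_i (1 + o i)^-1.
  by rewrite -{1}su; apply: ler_sum => i _; rewrite oE lerBrDr addrC -lerBrDr.
have [c c0 sc] := scale_exists o0 so.
pose a i := kappa c (p i).
have cp i : 0 < 1 + c * p i by rewrite ltr_wpDr ?ltr01 // mulr_ge0 // ltW.
have aE i : (1 + (1 + c) * o i)^-1 = a i.
  rewrite /a /kappa /o; field.
  by rewrite !gt_eqF //; have := cp i; have := q0 i; lra.
have sa : \sum_i a i = 1 by rewrite -sc; apply: eq_bigr => i _; rewrite aE.
have ma i : (1 + N%:R * (1 + c))^-1 <= a i < 1.
  have Np : p i <= N%:R * (1 - p i).
    have := pu i; rewrite -(ler_pM2l SN0) mulrBr mulfV ?gt_eqF // -natr1; lra.
  have N0' : 0 <= N%:R :> R by [].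
  rewrite /a /kappa ltr_pdivrMr // mul1r ler_pdivlMr //; apply/andP; split; last first.
    have := mulr_ge0 c0 (ltW (p0 i)); have := p0 i; lra.
  rewrite mulrC ler_pdivrMr; last by rewrite ltr_wpDr // mulr_ge0 // addr_ge0.
  have := ler_wpM2r (addr_ge0 ler01 c0) Np; lra.
have pE i : kappa c (a i) = p i by rewrite /a kappaK //; exact: ltW.
have prE : \prod_i kappa c (a i) = \prod_i p i by apply: eq_bigr.
have muE : \prod_i mu (kappa c (a i)) (F i) = \prod_i mu (p i) (F i).
  by apply: eq_bigr => i _; rewrite pE.
split.
  have [h _] := cmu_bounds N0 c0 sa ma cF iF (enum_uniq 'I_n)
    (B := fun=> set0) (fun i z _ => negbT (in_set0 z)) (fun z => ex_intro _ ord0 (negbT (in_set0 z))).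
  rewrite -prE -muE; apply: le_trans h; rewrite le_eqVlt; apply/orP; left; apply/eqP.
  by apply: eq_bigr => i _; apply: mu_cmu => [|x]; rewrite ?enum_uniq ?mem_enum.
move: c0; rewrite le_eqVlt => /orP[/eqP c0|c0] E; last first.
  by left; apply: (strict_equality N0 c0 sa ma cF iF); rewrite muE E.
have pu' i : p i = 1 - N.+1%:R^-1.
  have : \sum_i (1 - N.+1%:R^-1 - p i) = 0.
    rewrite (eq_bigr (fun i => (1 - p i) - N.+1%:R^-1)) => [|j _]; last by rewrite addrAC.
    rewrite big_split /= sumrN su -[in X in _ - X]sc -c0; apply/eqP; rewrite subr_eq0; apply/eqP.
    by apply: eq_bigr => j _; rewrite addr0 mul1r oE.
  move/eqP; rewrite psumr_eq0 => [/allP/(_ i (mem_index_enum i))|j _]; last by rewrite subr_ge0.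
  by rewrite subr_eq0 => /eqP <-.
have [N1|N1] := leqP N 1; first by right; split=> //; apply/eqP; rewrite eqn_leq N1.
left; apply: (uniform_equality (R := R) N1 cF iF).
rewrite -[RHS](eq_bigr _ (fun i _ => pu' i)) -E; apply: eq_bigr => i _.
by rewrite pu'.
Qed.

Definition up_closure (T : finType) (F : {set {set T}}) : {set {set T}} :=
  [set B : {set T} | [exists A in F, A \subset B]].

Lemma sub_up_closure (T : finType) (F : {set {set T}}) : F \subset up_closure F.
Proof. by apply/subsetP => A AF; rewrite inE; apply/exists_inP; exists A. Qed.

Lemma up_closure_increasing (n : nat) (F : {set {set 'I_n}}) : increasing_family (up_closure F).
Proof.
move=> A B; rewrite !inE => /exists_inP[C CF CA] AB.
by apply/exists_inP; exists C => //; apply: subset_trans AB.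
Qed.

Lemma cross_up_closure (n r : nat) (F : 'I_r -> {set {set 'I_n}}) :
  cross_intersecting F -> cross_intersecting (fun i => up_closure (F i)).
Proof.
move=> cF B BF.
pose A i := odflt set0 [pick C in F i | C \subset B i].
have AB i : A i \in F i /\ A i \subset B i.
  rewrite /A; case: pickP => [C /andP[] //|h].
  by have := BF i; rewrite inE => /exists_inP[C CF CB]; have := h C; rewrite CF CB.
have /set0Pn[z /bigcapP hz] := cF A (fun i => (AB i).1).
apply/set0Pn; exists z; apply/bigcapP => i _.
by apply: (subsetP (AB i).2); apply: hz.
Qed.

Lemma cross_bound (R : realType) (n N : nat) (p : 'I_N.+1 -> R)
    (F : 'I_N.+1 -> {set {set 'I_n}}) :
  (0 < N)%N -> (forall i, 0 < p i <= 1 - N.+1%:R^-1) -> cross_intersecting F ->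
  \prod_i mu (p i) (F i) <= \prod_i p i /\
  (\prod_i mu (p i) (F i) = \prod_i p i ->
    (forall i, increasing_family (F i)) /\
    ((exists x, forall i, F i = full_star x) \/
     N = 1%N /\ forall i, p i = 1 - N.+1%:R^-1)).
Proof.
move=> N0 hp cF.
have p0 i : 0 < p i by case/andP: (hp i).
have p1 i : p i < 1.
  by case/andP: (hp i) => _ /le_lt_trans; apply; rewrite ltrBlDr ltrDl invr_gt0 ltr0n.
have sub i := mu_subset (p0 i) (p1 i) (sub_up_closure (F i)).
have le i : 0 <= mu (p i) (F i) <= mu (p i) (up_closure (F i)).
  by rewrite (sub i).1 mu_ge0 // ltW.
have [b eqb] := increasing_bound N0 hp (cross_up_closure cF) (fun i => up_closure_increasing (F := F i)).
have leu : \prod_i mu (p i) (F i) <= \prod_i mu (p i) (up_closure (F i)) by apply: ler_prod.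
split=> [|E]; first exact: le_trans b.
have Eu : \prod_i mu (p i) (F i) = \prod_i mu (p i) (up_closure (F i)).
  by apply/eqP; rewrite eq_le leu E b.
have uE i : F i = up_closure (F i).
  apply: (sub i).2; apply: (prod_eq_pointwise le _ Eu i); rewrite E.
  exact: prodr_gt0.
split=> [i|]; first by rewrite uE; apply: up_closure_increasing.
have [[x hx]|h] := eqb (etrans (esym Eu) E); last by right.
by left; exists x => i; rewrite uE hx.
Qed.

Lemma mu0 (R : realType) (n : nat) (F : {set {set 'I_n}}) : mu 0 F = (set0 \in F)%:R :> R.
Proof.
rewrite (@mu_cmu _ _ _ _ (enum 'I_n)) ?enum_uniq // => [|x]; last by rewrite mem_enum.
by elim: (enum _) => [|x s IH] //=; rewrite mul0r add0r subr0 mul1r.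
Qed.

Lemma cross_prod0 (R : realType) (n r : nat) (p : 'I_r -> R) (F : 'I_r -> {set {set 'I_n}}) i :
  cross_intersecting F -> p i = 0 -> \prod_j mu (p j) (F j) = 0.
Proof.
move=> cF pi0; have [Fi|Fi] := boolP (set0 \in F i); last first.
  by rewrite (bigD1 i) //= pi0 mu0 (negbTE Fi) mul0r.
have [j /eqP Fj|h] := pickP (fun j => F j == set0).
  by rewrite (bigD1 j) //= Fj /mu big_set0 mul0r.
pose A j := if j == i then set0 else odflt set0 [pick C in F j].
have AF j : A j \in F j.
  rewrite /A; have [->//|_] := eqVneq j i; case: pickP => [//|h'].
  by have /set0Pn[C CF] := negbT (h j); have := h' C; rewrite CF.
have /set0Pn[z /bigcapP/(_ i isT)] := cF A AF.
by rewrite /A eqxx inE.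
Qed.

Lemma mu_half_dual (R : realType) (n : nat) (F : {set {set 'I_n}}) :
  mu (1 / 2 : R) (dual_family F) = 1 - mu (1 / 2 : R) F.
Proof.
rewrite -[X in X - _](mu_setT n (1 / 2 : R)) /mu [X in X - _](big_setID F) /= setTI.
rewrite [X in X - _]addrC addrK.
rewrite (reindex_inj (inv_inj (@setCK _))) /=.
apply: eq_big => [A|A _]; first by rewrite !inE setCK andbT.
have -> : 1 - 1 / 2 = 1 / 2 :> R by field.
have le_n (B : {set 'I_n}) : (#|B| <= n)%N by rewrite -[leqRHS]card_ord max_card.
by rewrite -!exprD !subnKC.
Qed.

Lemma cross_sub_dual (n : nat) (F : 'I_2 -> {set {set 'I_n}}) (i j : 'I_2) :
  i != j -> cross_intersecting F -> F j \subset dual_family (F i).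
Proof.
move=> ij cF; apply/subsetP => B BF; rewrite inE; apply/negP => BC.
pose A k := if k == j then B else ~: B.
have AF k : A k \in F k.
  rewrite /A; have [->//|kj] := eqVneq k j.
  have -> // : k = i.
  by apply/val_inj; move: i j k ij kj {BF BC A} => [[|[|?]] ?] [[|[|?]] ?] [[|[|?]] ?].
have /set0Pn[z /bigcapP hz] := cF A AF.
by have := hz i isT; have := hz j isT; rewrite /A eqxx (negbTE ij) inE => ->.
Qed.

Theorem theorem1p9 (R : realType) (n r : nat) (hn : (1 <= n)%N) (hr : (2 <= r)%N)
    (p : 'I_r -> R)
    (hp : forall i : 'I_r, 0 <= p i <= (r%:R - 1) / r%:R)
    (F : 'I_r -> {set {set 'I_n}})
    (hF : cross_intersecting F) :
  [/\ \prod_(i < r) mu (p i) (F i) <= \prod_(i < r) p i,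
      (exists i : 'I_r, p i = 0) ->
        \prod_(i < r) mu (p i) (F i) = 0 /\ \prod_(i < r) p i = 0,
      (forall i : 'I_r, 0 < p i) ->
        (3 <= r)%N \/ (r = 2%N /\ (p (idx1 hr), p (idx2 hr)) <> (1 / 2, 1 / 2)) ->
        (\prod_(i < r) mu (p i) (F i) = \prod_(i < r) p i <->
         exists x : 'I_n, forall i : 'I_r, F i = full_star x)
    & r = 2%N -> p (idx1 hr) = 1 / 2 -> p (idx2 hr) = 1 / 2 ->
        (\prod_(i < r) mu (p i) (F i) = \prod_(i < r) p i <->
         exists G : {set {set 'I_n}},
           [/\ increasing_family G, mu (1 / 2 : R) G = 1 / 2,
               F (idx1 hr) = G & F (idx2 hr) = dual_family G])].
Proof.
case: r hr p hp F hF => [//|N] hr p hp F hF.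
have pu i : p i <= 1 - N.+1%:R^-1.
  case/andP: (hp i) => _; rewrite mulrBl mul1r mulfV //.
  by rewrite pnatr_eq0.
have zero : (exists i, p i = 0) -> \prod_i mu (p i) (F i) = 0 /\ \prod_i p i = 0.
  case=> i pi0; split; first exact: cross_prod0 pi0.
  by rewrite (bigD1 i) //= pi0 mul0r.
have pos : (forall i, 0 < p i) -> forall i, 0 < p i <= 1 - N.+1%:R^-1.
  by move=> p0 i; rewrite p0 pu.
split=> //.
- have [i /eqP pi0|p0] := pickP (fun i => p i == 0).
    by have [-> ->] := zero (ex_intro _ i pi0).
  apply: (cross_bound hr (pos _) hF).1 => i.
  by rewrite lt_neqAle eq_sym (negbT (p0 i)); case/andP: (hp i).
- move=> p0 hyp; split=> [E|[x hx]]; last by apply: eq_bigr => i _; rewrite hx mu_full_star.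
  have [_ [//|[N1 ph]]] := (cross_bound hr (pos p0) hF).2 E.
  case: hyp => [N2|[_ []]]; first by rewrite N1 in N2.
  have e : 1 - N.+1%:R^-1 = 1 / 2 :> R by rewrite [X in X.+1]N1; field.
  by rewrite !ph e.
move=> r2; have {r2}N1 : N = 1%N by case: r2.
subst N => h1 h2.
have prod2 (f : 'I_2 -> R) : \prod_i f i = f (idx1 hr) * f (idx2 hr).
  rewrite big_ord_recl big_ord1.
  by congr (f _ * f _); apply: val_inj.
rewrite !prod2 h1 h2; split=> [E|[G [iG mG -> ->]]]; last by rewrite mu_half_dual mG; field.
have p0 i : 0 < p i.
  have [->|->] : i = idx1 hr \/ i = idx2 hr.
  - by case: i => [[|[|k]] ik] //; [left|right]; apply: val_inj.
  - by rewrite h1 divr_gt0 ?ltr0n.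
  by rewrite h2 divr_gt0 ?ltr0n.
have [_ [|iF _]] := cross_bound (N := 1) hr (pos p0) hF; first by rewrite !prod2 h1 h2.
have half0 : 0 < 1 / 2 :> R by rewrite divr_gt0 ?ltr0n.
have half1 : 1 / 2 < 1 :> R by lra.
have [ld eqd] := mu_subset half0 half1 (cross_sub_dual (isT : idx1 hr != idx2 hr) hF).
have m10 := mu_ge0 (F (idx1 hr)) (ltW half0) (ltW half1).
rewrite mu_half_dual in ld eqd.
set m1 := mu _ (F (idx1 hr)) in E ld eqd m10; set m2 := mu _ (F (idx2 hr)) in E ld eqd.
have m1E : m1 = 1 / 2.
  have sq : (m1 - 1 / 2) ^+ 2 <= 0 by have := ler_wpM2l m10 ld; rewrite E expr2; lra.
  apply/eqP; rewrite -subr_eq0 -sqrf_eq0 eq_le sq; exact: sqr_ge0.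
exists (F (idx1 hr)); split=> //; apply: eqd; move: E; rewrite m1E; lra.
Qed.
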